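(* Let $m/n\in(0,1/2)$ with $m>1$, and $1\le i<\alpha$. There is a bijection from $(0,1)\cap\mathbb Q$ to $TT(m/n,k_i,B)$ sending $p/q$ (lowest terms) to the orbit $P_{i,p/q,m/n}$ whose data $((N_r),\pi,(A,B,C))$ is: $A=\{p\}$, $B=\{0,\dots,q-1\}\setminus\{p\}$, $C=\{q\}$; $N_r=1$ for $r\in R$, $N_r=q+1-p$ for $r\in S$, $N_r=q+1$ for $r\in T$; and $\pi(0,s)=(k_i,q-p+s)$ for $0\le s<p$, $\pi(0,p)=(k_{i+1},q-p)$, $\pi(0,s)=(k_{i+1},s-p)$ for $p+1\le s<q$, $\pi(0,q)=(m,0)$; $\pi(k_i+n-m,q-p)=(k_i,q)$; and $\pi(r,s)=(r+_nm,s)$ for all other $(r,s)$.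
   Context: Rationals in lowest terms; $\mathrm{LFS}(m/n)=(0=u_1/v_1,\dots,u_\alpha/v_\alpha)$ is the left Farey sequence ($u_\alpha/v_\alpha$ the left Farey parent of $m/n$, each term the left Farey parent of the next). $+_n$ is addition mod $n$; $\mathcal O_{m/n}[r,s]$ is the segment $r,r+_nm,r+_n2m,\dots,s$ of the orbit of $r$ under addition of $m$ mod $n$. $\mathcal A_{m/n}=\{k\in[0,m-1]\colon\{k+1,\dots,m-1\}\cap\mathcal O_{m/n}[k,0]=\emptyset\}$, with elements $0=k_1<\cdots<k_\alpha=m-1$. For $i<\alpha$: $R=\mathcal O_{m/n}[m,k_{i+1}+n-m]$, $S=\mathcal O_{m/n}[k_{i+1},k_i+n-m]$, $T=\mathcal O_{m/n}[k_i,0]$ (a partition of $\mathbb Z_n$). Star setting: $\Gamma_n$ an $n$-star with edges $e_0,\dots,e_{n-1}$ and central vertex $v$; $f_{m/n}(e_0)=e_0\bar e_1e_1\cdots\bar e_me_m$, $f_{m/n}(e_r)=e_{r+_nm}$ ($r\ne0$). A $\ast$-orbit is a periodic orbit $P\ne\{v\}$ meeting every edge with $f(P\cap e_0)\not\subseteq e_m$ and $f(p_r)=p_{r+_nm}$ for $r\ne0$ ($p_r$ nearest point of $P\cap e_r$ to the initial point). Data $((N_r),\pi,(A,B,C))$: $N_r=\#(P\cap e_r)$; points labelled $(r,0),\dots,(r,N_r-1)$ from the initial point; $\pi=f|_P$; $s\in A,B,C$ according as the truncated map ($f$ followed by retraction onto the span of $P$) is locally orientation-reversing, orientation-preserving,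 or non-injective at $(0,s)$. Orbits with equal data are identified. $\mathcal P(m/n,k,\gamma)$: $\ast$-orbits with $\pi(0,0)\in e_k$, $0\in\gamma$. $TT(m/n,k,\gamma)$: those satisfying, with $\pi_j=\tau_j\circ\pi$ ($\tau_j$ coordinate projections) and $\alpha\cup\beta$ the partition of $\mathcal L\setminus\{(r,0)\}$ given by $\pi^{-1}(m,0)\in\beta$ and $\pi^{-i}(m,0),\pi^{-i+1}(m,0)$ ($2\le i\le\#P-n$) in different sets iff $\tau_1(\pi^{-i}(m,0))=0$ and $\tau_2(\pi^{-i}(m,0))\in A$: (a) for $s<N_0-1$, $\pi(0,s)\in\alpha$ if $s\in B$, $\in\beta$ if $s\in A$; (b) $N_{r+n-m}=1$ for $k<r<m$; (c) if $s>0$ and $\pi_2(k+n-m,s)>\pi_2(0,0)$ then $\pi(k+n-m,s)\in\beta$; (d) if $\gamma=A$ then $\pi_2(k+n-m,s)>\pi_2(0,0)$ for all $s>0$. *)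

(* Defs.v *)
From mathcomp Require Import all_boot.
From Stdlib Require Import Reals.

Set Implicit Arguments.
Unset Strict Implicit.
Unset Printing Implicit Defensive.

(* x lies on the orbit segment O_{m/n}[r,s] = r, r+_n m, ..., s.
   (Under gcd(m,n)=1 the segment has at most n terms.) *)
Definition insegb (n m r s x : nat) : bool :=
  [exists j : 'I_n, (x == (r + j * m) %% n) &&
     [forall j' : 'I_n, (j' < j) ==> ((r + j' * m) %% n != s %% n)]].

Definition Apred (n m k : nat) : bool :=
  (k < m) && [forall x : 'I_m, (k < x) ==> ~~ insegb n m k 0 x].

Definition Alist (n m : nat) : seq nat := [seq k <- iota 0 m | Apred n m k].
Definition alpha (n m : nat) : nat := size (Alist n m).
Definition kk (n m i : nat) : nat := nth 0 (Alist n m) i.-1.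

(* SV is the central vertex v; SE r t (r < n, 0 <= t < 1) is the point of
   edge e_r at parameter t, where t = 0 is the initial point of e_r (the
   leaf) and t -> 1 approaches v (edges are oriented towards v, as forced by
   f(e_0) = e_0 ebar_1 e_1 ... ebar_m e_m being an edge path). *)
Inductive spt := SV | SE of nat & R.

Definition valid (n : nat) (x : spt) : Prop :=
  match x with SV => True | SE r t => r < n /\ (0 <= t)%R /\ (t < 1)%R end.

(* f on e_0: e_0 is cut into 2m+1 equal pieces, mapped linearly onto
   e_0, ebar_1, e_1, ..., ebar_m, e_m in that order. *)
Definition fe0 (m : nat) (t : R) : spt :=
  let s := (INR (2 * m + 1) * t)%R in
  let j := Z.to_nat (Int_part s) in
  let u := (s - INR j)%R in
  if j == 0 then SE 0 u
  else if odd j then (if Req_EM_T u 0 then SV else SE (j.+1 %/ 2) (1 - u)%R)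
  else SE (j %/ 2) u.

Definition fstar (n m : nat) (x : spt) : spt :=
  match x with
  | SV => SV
  | SE r t => if r == 0 then fe0 m t else SE ((r + m) %% n) t
  end.

Definition orbit_of (n m : nat) (x0 y : spt) : Prop :=
  exists j, y = iter j (fstar n m) x0.

Definition periodic_pt (n m : nat) (x0 : spt) : Prop :=
  valid n x0 /\ exists k, 0 < k /\ iter k (fstar n m) x0 = x0.

Definition nearest (n m : nat) (x0 : spt) (r : nat) (t : R) : Prop :=
  orbit_of n m x0 (SE r t) /\
  forall t', orbit_of n m x0 (SE r t') -> (t <= t')%R.

Definition star_orbit (n m : nat) (x0 : spt) : Prop :=
  periodic_pt n m x0 /\
  (exists y, orbit_of n m x0 y /\ y <> SV) /\
  (forall r, r < n -> exists t, orbit_of n m x0 (SE r t)) /\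
  (exists t, orbit_of n m x0 (SE 0 t) /\ fstar n m (SE 0 t) <> SV /\
             forall u, fstar n m (SE 0 t) <> SE m u) /\
  (forall r t t', 0 < r < n -> nearest n m x0 r t ->
      nearest n m x0 ((r + m) %% n) t' ->
      fstar n m (SE r t) = SE ((r + m) %% n) t').

Record data := Data {
  dN  : nat -> nat;
  dpi : nat * nat -> nat * nat;
  dA  : nat -> bool;
  dB  : nat -> bool;
  dC  : nat -> bool }.

(* truncated map: f followed by the retraction onto the span of P, where
   lo r is the parameter of p_r (so span P = {v} U {SE r t | t >= lo r}) *)
Definition trunc (n m : nat) (lo : nat -> R) (x : spt) : spt :=
  match fstar n m x with
  | SV => SV
  | SE r t => if Rlt_dec t (lo r) then SE r (lo r) else SE r t
  end.

Definition loc_pres (n m : nat) (lo : nat -> R) (t0 : R) : Prop :=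
  exists d, (0 < d)%R /\ forall t1 t2,
    (lo O <= t1)%R -> (t1 < t2)%R -> (t2 < 1)%R ->
    (t0 - d < t1)%R -> (t2 < t0 + d)%R ->
    exists r u1 u2, trunc n m lo (SE 0 t1) = SE r u1 /\
                    trunc n m lo (SE 0 t2) = SE r u2 /\ (u1 < u2)%R.

Definition loc_rev (n m : nat) (lo : nat -> R) (t0 : R) : Prop :=
  exists d, (0 < d)%R /\ forall t1 t2,
    (lo O <= t1)%R -> (t1 < t2)%R -> (t2 < 1)%R ->
    (t0 - d < t1)%R -> (t2 < t0 + d)%R ->
    exists r u1 u2, trunc n m lo (SE 0 t1) = SE r u1 /\
                    trunc n m lo (SE 0 t2) = SE r u2 /\ (u2 < u1)%R.

Definition loc_noninj (n m : nat) (lo : nat -> R) (t0 : R) : Prop :=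
  forall d, (0 < d)%R -> exists t1 t2,
    (lo O <= t1)%R /\ (t1 < t2)%R /\ (t2 < 1)%R /\
    (t0 - d < t1)%R /\ (t2 < t0 + d)%R /\
    trunc n m lo (SE 0 t1) = trunc n m lo (SE 0 t2).

Definition has_data (n m : nat) (x0 : spt) (D : data) : Prop :=
  exists lab : nat -> nat -> R,
    (forall r s, r < n -> s < dN D r -> (0 <= lab r s)%R /\ (lab r s < 1)%R) /\
    (forall r s1 s2, r < n -> s1 < s2 -> s2 < dN D r -> (lab r s1 < lab r s2)%R) /\
    (forall y, orbit_of n m x0 y <->
        exists r s, r < n /\ s < dN D r /\ y = SE r (lab r s)) /\
    (forall r s, r < n -> s < dN D r ->
        (dpi D (r, s)).1 < n /\ (dpi D (r, s)).2 < dN D (dpi D (r, s)).1 /\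
        fstar n m (SE r (lab r s)) =
          SE (dpi D (r, s)).1 (lab (dpi D (r, s)).1 (dpi D (r, s)).2)) /\
    (forall s, s < dN D 0 ->
        (dA D s <-> loc_rev n m (fun r => lab r 0) (lab 0 s)) /\
        (dB D s <-> loc_pres n m (fun r => lab r 0) (lab 0 s)) /\
        (dC D s <-> loc_noninj n m (fun r => lab r 0) (lab 0 s))).

(* Equality of data (orbits with equal data are identified) *)
Definition data_eq (n : nat) (D1 D2 : data) : Prop :=
  (forall r, r < n -> dN D1 r = dN D2 r) /\
  (forall r s, r < n -> s < dN D1 r -> dpi D1 (r, s) = dpi D2 (r, s)) /\
  (forall s, s < dN D1 0 ->
     dA D1 s = dA D2 s /\ dB D1 s = dB D2 s /\ dC D1 s = dC D2 s).

Inductive abc := cA | cB | cC.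
Definition in_class (D : data) (g : abc) (s : nat) : bool :=
  match g with cA => dA D s | cB => dB D s | cC => dC D s end.

Definition card_orbit (n : nat) (D : data) : nat := \sum_(r < n) dN D r.

(* pi^{-i}(m,0); pi is a cyclic permutation of the #P labels, so its
   inverse is pi^(#P - 1) *)
Definition piinv (n m : nat) (D : data) (i : nat) : nat * nat :=
  iter (card_orbit n D - i) (dpi D) (m, 0).

Definition flip (D : data) (x : nat * nat) : bool := (x.1 == 0) && dA D x.2.

(* colour of pi^{-i}(m,0): true = beta, false = alpha *)
Fixpoint colb (n m : nat) (D : data) (i : nat) : bool :=
  match i with
  | 0 => true
  | i'.+1 => if i' == 0 then true
             else xorb (colb n m D i') (flip D (piinv n m D i))
  end.

Definition in_beta (n m : nat) (D : data) (x : nat * nat) : Prop :=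
  exists i, 1 <= i <= card_orbit n D - n /\ piinv n m D i = x /\ colb n m D i.
Definition in_alpha (n m : nat) (D : data) (x : nat * nat) : Prop :=
  exists i, 1 <= i <= card_orbit n D - n /\ piinv n m D i = x /\ ~~ colb n m D i.

Definition inTT (n m k : nat) (g : abc) (D : data) : Prop :=
  exists x0, star_orbit n m x0 /\ has_data n m x0 D /\
    (dpi D (0, 0)).1 = k /\ in_class D g 0 /\
    (forall s, s.+1 < dN D 0 ->
       (dB D s -> in_alpha n m D (dpi D (0, s))) /\
       (dA D s -> in_beta n m D (dpi D (0, s)))) /\
    (forall r, k < r < m -> dN D (r + n - m) = 1) /\
    (forall s, 0 < s -> s < dN D (k + n - m) ->
       (dpi D (0, 0)).2 < (dpi D (k + n - m, s)).2 ->
       in_beta n m D (dpi D (k + n - m, s))) /\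
    (g = cA -> forall s, 0 < s -> s < dN D (k + n - m) ->
       (dpi D (0, 0)).2 < (dpi D (k + n - m, s)).2).

Definition Pdata (n m i p q : nat) : data :=
  let ki := kk n m i in
  let ki1 := kk n m i.+1 in
  Data
    (fun r => if insegb n m m (ki1 + n - m) r then 1
              else if insegb n m ki1 (ki + n - m) r then q + 1 - p
              else if insegb n m ki 0 r then q + 1
              else 0)
    (fun x => let: (r, s) := x in
       if (r == 0) && (s < p) then (ki, q - p + s)
       else if (r == 0) && (s == p) then (ki1, q - p)
       else if (r == 0) && (p < s < q) then (ki1, s - p)
       else if (r == 0) && (s == q) then (m, 0)
       else if (r == ki + n - m) && (s == q - p) then (ki, q)
       else ((r + m) %% n, s))
    (fun s => s == p)
    (fun s => (s < q) && (s != p))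
    (fun s => s == q).

(* Main.v *)
Require Import Defs.
From mathcomp Require Import all_boot.
From Stdlib Require Import Reals Lra.
From mathcomp Require Import zify.

(* Order Z_n by time along the orbit m, 2m, ..., nm = 0.  The elements of A_{m/n} are
   the records of this sequence, so k_{i+1} comes before k_i, and no residue strictly
   between k_i and m comes after k_{i+1}; hence R, S, T are consecutive blocks of time.
   Since f is isometric off e_0, an orbit is governed by its first-return map to e_0,
   which on parameters is T(t) = (2m+1)t - 2r or 2r - (2m+1)t on the pieces lying over e_r.

   Existence: for the data P_{i,p/q} the return map permutes 0, ..., q as the rotation by
   -p on Z_q with p -> 0 subdivided as p -> q -> 0.  The inverse branches of T contract, so
   there is a periodic orbit of T with this itinerary.  Two points x_s, x_s' with s < s'
   are carried along in the same order until the itinerary of s reaches p, and then their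
   branches differ; so the points are in the prescribed order.

   Uniqueness: condition (a) forces every (0,s) with 0 < s < N_0 - 1 to be in alpha, while
   (0, N_0 - 1) is in beta.  Hence s is in A exactly when (0,s) returns to the top point
   N_0 - 1, so A = {p} for one p, and p is the first index not mapped to e_{k_i}.
   Condition (c) makes the points entering e_{k_i} from e_0 a block just below the top
   point.  All remaining points are placed by monotonicity, and since the return map is a
   single cycle, p and q are coprime. *)

Set Implicit Arguments.
Unset Strict Implicit.
Unset Printing Implicit Defensive.

(** * Rotation by m modulo n and the set A_{m/n} *)

(** In [Z_n] time is counted from 1 to [n]: for [m < n] coprime, the orbit starts at [m], ends at 0,
    and each residue has exactly one time. *)
Definition orbitn (n m j : nat) : nat := (j * m) %% n.

Section Rotation.
Variables n m : nat.
Hypotheses (n_gt0 : 0 < n) (co : coprime m n).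
Let E := orbitn n m.

Lemma ltn_orbitn j : E j < n.
Proof. by rewrite ltn_mod. Qed.

Lemma orbitnS j : E j.+1 = (E j + m) %% n.
Proof. by rewrite /E /orbitn modnDml mulSn addnC. Qed.

Lemma orbitn_add j c : E (j + c) = (E j + c * m) %% n.
Proof. by rewrite /E /orbitn modnDml mulnDl. Qed.

Lemma orbitn_n : E n = 0.
Proof. by rewrite /E /orbitn mulnC modnMl. Qed.

Lemma orbitn_inj j l : 0 < j <= n -> 0 < l <= n -> E j = E l -> j = l.
Proof.
wlog jl : j l / j <= l => [H hj hl e | /andP[j0 jn] /andP[l0 ln] e].
  by case: (leqP j l) => h; [exact: H | symmetry; apply: H => //; lia].
have : E l == E j by rewrite e.
rewrite /E /orbitn (eqn_mod_dvd n (_ : j * m <= l * m)) ?leq_mul2r ?jl ?orbT //.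
rewrite -mulnBl Gauss_dvdl 1?coprime_sym // => d.
case: (posnP (l - j)) => [|h]; first lia.
by have := dvdn_leq h d; lia.
Qed.

Lemma orbitn_surj r : r < n -> exists2 j, 0 < j <= n & E j = r.
Proof.
move=> rn.
pose f (j : 'I_n) := Ordinal (ltn_orbitn j.+1).
have f_inj : injective f.
  move=> x y /(congr1 val) /= e; apply/val_inj/succn_inj.
  by apply: orbitn_inj e; rewrite /= ltn_ord.
have [j fj] := codomP (injF_onto f_inj (Ordinal rn)).
by exists j.+1; [rewrite ltn_ord | have := congr1 val fj].
Qed.

Lemma orbitn_eq0 j : 0 < j <= n -> E j = 0 -> j = n.
Proof. by move=> hj e; apply: orbitn_inj => //; [rewrite n_gt0 leqnn | rewrite orbitn_n]. Qed.

(** Residues at times [1..n] are distinct, so the first-hit clause of [insegb] stops exactly at time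
    [l], and orbit segments become intervals of times. *)
Lemma insegb_orbitn j l x : 0 < j -> j <= l <= n ->
  insegb n m (E j) (E l) x <-> exists2 c, j <= c <= l & x = E c.
Proof.
move=> j0 /andP[jl ln]; split.
  case/existsP => i /andP[/eqP -> /forallP h].
  exists (j + i); last by rewrite orbitn_add.
  rewrite leq_addr leqNgt; apply/negP => li.
  have lt : l - j < n by lia.
  have := h (Ordinal lt); rewrite /= (_ : l - j < i); last lia.
  by rewrite -orbitn_add subnKC // /E /orbitn modn_mod eqxx.
case=> c /andP[jc cl] ->.
have lt : c - j < n by lia.
apply/existsP; exists (Ordinal lt); rewrite /= -orbitn_add subnKC // eqxx /=.
apply/forallP => i; apply/implyP => ic; rewrite -orbitn_add.
apply/eqP; rewrite (modn_small (ltn_orbitn l)) => e.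
by have := @orbitn_inj (j + i) l _ _ e; lia.
Qed.

Lemma insegb_orbitnE j l x : 0 < j -> j <= l <= n -> 0 < x <= n ->
  insegb n m (E j) (E l) (E x) = (j <= x <= l).
Proof.
move=> j0 jl hx; apply/idP/idP => [|h].
  case/(insegb_orbitn _ j0 jl) => c hc e.
  by rewrite (orbitn_inj hx _ e) //; lia.
by apply/(insegb_orbitn _ j0 jl); exists x.
Qed.

(** A residue below [m] can only be entered by wrapping past [n], so adding [n - m] undoes one step.
    This gives the edges [k + n - m] their times. *)
Lemma orbitn_pred j : m < n -> 1 < j -> E j < m -> E j + n - m = E j.-1.
Proof.
move=> mn; case: j => // j j1; rewrite orbitnS /= => lt.
have := ltn_orbitn j => h.
case: (ltnP (E j + m) n) => c; first by move: lt; rewrite modn_small //; lia.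
have -> : E j + m = (E j + m - n) + n by lia.
by rewrite modnDr modn_small; lia.
Qed.

End Rotation.

(** * Records of the orbit and the times of [k_i] and [k_{i+1}] *)

Section Records.
Variables m n i : nat.
Hypotheses (m_gt1 : 1 < m) (m_lt_n : m < n) (co : coprime m n).
Hypothesis (hi : 0 < i < alpha n m).
Let E := orbitn n m.
Let k := kk n m i.
Let k' := kk n m i.+1.
Let n_gt0 : 0 < n. Proof. lia. Qed.

Lemma orbitn1 : E 1 = m.
Proof. by rewrite /E /orbitn mul1n modn_small. Qed.

Lemma Alist_sorted : sorted ltn (Alist n m).
Proof. exact: (sorted_filter ltn_trans _ (iota_ltn_sorted 0 m)). Qed.

Lemma mem_Alist x : x \in Alist n m -> Apred n m x.
Proof. by rewrite mem_filter => /andP[]. Qed.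

Lemma index_kk : (i.-1 < size (Alist n m)) * (i < size (Alist n m)).
Proof. by case/andP: hi => i0 ia; split=> //; apply: leq_ltn_trans ia; lia. Qed.

Lemma Apred_kk : Apred n m k /\ Apred n m k'.
Proof. by split; apply/mem_Alist/mem_nth; rewrite ?index_kk. Qed.

Lemma kk_lt : k < k' < m.
Proof.
have [_ /andP[-> _]] := Apred_kk; rewrite andbT.
apply: (sorted_ltn_nth ltn_trans 0 Alist_sorted); rewrite ?inE ?index_kk //; move: hi; lia.
Qed.

Lemma kk_consecutive x : k < x < k' -> ~~ Apred n m x.
Proof.
move=> hx; apply/negP => Ax.
have xA : x \in Alist n m by rewrite mem_filter Ax mem_iota; have := kk_lt; lia.
have si := sorted_ltn_nth ltn_trans 0 Alist_sorted.
set j := index x (Alist n m).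
have jx : nth 0 (Alist n m) j = x by exact: nth_index.
have js : j < size (Alist n m) by rewrite index_mem.
have is_ : i < size (Alist n m) by case/andP: hi.
case: (ltngtP j i.-1) => c.
- have := si j i.-1 js _ c; rewrite inE jx => /(_ ltac:(lia)).
  by move: hx; rewrite /k /kk; lia.
- case: (ltngtP j i) => c'; first lia.
  + have := si i j is_ js c'; rewrite jx.
    by move: hx; rewrite /k' /kk /=; lia.
  + by move: hx; rewrite /k' /kk /= -c' jx; lia.
- by move: hx; rewrite /k /kk -c jx; lia.
Qed.

(** The segment from [E b] to 0 is the time interval [[b, n]], so [E b] has to be the largest of the
    remaining residues below [m]. *)
Lemma Apred_orbitn b : 0 < b <= n -> E b < m ->
  Apred n m (E b) <-> forall j, b <= j <= n -> E j < m -> E j <= E b.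
Proof.
move=> hb lt.
have seg x : insegb n m (E b) 0 x <-> exists2 c, b <= c <= n & x = E c.
  by rewrite -{1}(orbitn_n n m); apply: insegb_orbitn => //; lia.
rewrite /Apred lt /=; split.
  move=> /forallP h j hj lj; rewrite leqNgt; apply/negP => c.
  have /implyP/(_ c)/negP := h (Ordinal lj); apply.
  by apply/seg; exists j.
move=> h; apply/forallP => x; apply/implyP => bx; apply/negP.
move=> /seg [j hj e].
have := h j hj; rewrite -e (ltn_ord x) => /(_ isT).
by move: bx; rewrite /=; lia.
Qed.

(** With these times R, S, T become [[1, a-1]], [[a, b-1]], [[b, n]]. The last clause links
    condition (b) to R: an edge strictly between [k] and [m] has its predecessor at a time less than
    [a]. *)
Lemma kk_times : exists a b, [/\ 1 < a < b, b <= n, E a = k', E b = k &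
  forall j, 0 < j <= n -> k < E j < m -> j <= a].
Proof.
have [Ak Ak'] := Apred_kk; have /andP[kk' k'm] := kk_lt.
have [a ha ea] := @orbitn_surj n m n_gt0 co k' ltac:(lia).
have [b hb eb] := @orbitn_surj n m n_gt0 co k ltac:(lia).
have hA j : a <= j <= n -> E j < m -> E j <= k'.
  by rewrite -ea; apply Apred_orbitn => //; rewrite /E ea.
have hB j : b <= j <= n -> E j < m -> E j <= k.
  by rewrite -eb; apply Apred_orbitn => //; rewrite /E eb //; apply: ltn_trans k'm.
have inj := orbitn_inj n_gt0 co.
have a1 : a != 1 by apply/eqP => e; move: ea; rewrite e; have := orbitn1; rewrite /E; lia.
have ab : a < b.
  rewrite ltnNge; apply/negP => c.
  by have := hB a; rewrite /E ea; lia.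
exists a, b; split=> //; try lia.
(* Induction on [k' - E j]. At a time [j >= a] such a residue would be a record: a later larger one
   is either below [k'], excluded by induction, or at least [k'], which from time [a] on is only
   [k'] itself, at time [a]. *)
suff H d j : k' - E j <= d -> 0 < j <= n -> k < E j < k' -> j < a.
  move=> j hj hE; case: (ltngtP (E j) k') => c.
  - by apply: ltnW; apply: (H _ j (leqnn _)) => //; lia.
  - by rewrite leqNgt; apply/negP => aj; have := hA j; lia.
  - by rewrite (inj j a) // /E ea.
elim: d j => [|d IH] j hd hj hE; first lia.
have /negP := kk_consecutive hE; case: (ltnP j a) => // aj; case.
apply/Apred_orbitn => //; first by lia.
move=> l hl lm; rewrite leqNgt; apply/negP => jl.
case: (ltnP (E l) k') => c; first by have := IH l; lia.
suff la : l = a by move: hE; rewrite (_ : j = a) ?/E ?ea; lia.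
apply: inj => //; first lia.
have := hA l; move: c jl lm; rewrite ea -/(E l); lia.
Qed.

End Records.

(** * The map f on e_0 *)

Definition sg (rev : bool) : R := if rev then (-1)%R else 1%R.

Lemma INR_odd m : INR (2 * m + 1) = (2 * INR m + 1)%R.
Proof. by rewrite -plusE -multE plus_INR mult_INR /=; lra. Qed.

Lemma INR_leq i j : i <= j -> (INR i <= INR j)%R.
Proof. by move=> h; apply: le_INR; lia. Qed.

Lemma INR_ltn i j : i < j -> (INR i + 1 <= INR j)%R.
Proof. by move=> h; rewrite -S_INR; apply: INR_leq. Qed.

Lemma floor_nat s j : (INR j <= s < INR j + 1)%R -> Z.to_nat (Int_part s) = j.
Proof.
move=> h; rewrite -(Int_part_spec s (Z.of_nat j)) ?Znat.Nat2Z.id //.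
by rewrite -INR_IZR_INZ; lra.
Qed.

Lemma floor_natP s : (0 <= s)%R ->
  (INR (Z.to_nat (Int_part s)) <= s < INR (Z.to_nat (Int_part s)) + 1)%R.
Proof.
move=> h; have [h1 h2] := base_Int_part s.
have : (-1 < Int_part s)%Z by apply: lt_IZR; lra.
by move=> ?; rewrite INR_IZR_INZ Znat.Z2Nat.id; [lra | lia].
Qed.

(** After scaling by [2m+1], the piece running forwards over [e_r] is [[2r, 2r+1]] and the one
    running backwards is [[2r-1, 2r]]; one linear equation with a sign covers both. *)
Lemma fe0E m (rev : bool) r t y : (rev -> 0 < r) -> (0 < y < 1)%R ->
  ((2 * INR m + 1) * t = 2 * INR r + sg rev * y)%R -> fe0 m t = SE r y.
Proof.
move=> hr hy e; rewrite /fe0 INR_odd.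
case: rev hr e => [/(_ isT) hr|_]; rewrite /sg.
  case: r hr => // r _; rewrite S_INR => e.
  have er : INR (2 * r + 1) = (2 * INR r + 1)%R by exact: INR_odd.
  rewrite (@floor_nat _ (2 * r + 1)) er; last lra.
  have -> : (2 * r + 1 == 0) = false by lia.
  have -> : odd (2 * r + 1) by lia.
  case: (Req_dec_T _ _) => u0; first lra.
  by congr SE; [lia | lra].
move=> e; have er : INR (2 * r) = (2 * INR r)%R by rewrite -multE mult_INR.
rewrite (@floor_nat _ (2 * r)) er; last lra.
have eu : ((2 * INR m + 1) * t - 2 * INR r = y)%R by lra.
case: eqP => [r0|_]; first by congr SE; [lia | lra].
rewrite (_ : odd (2 * r) = false); last lia.
by congr SE; [lia | lra].
Qed.

Lemma fe0_inv m t r y : (0 <= t < 1)%R -> (0 < y)%R -> fe0 m t = SE r y ->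
  [/\ r <= m, (y < 1)%R & exists2 rev : bool, rev -> 0 < r &
    ((2 * INR m + 1) * t = 2 * INR r + sg rev * y)%R].
Proof.
move=> ht hy; rewrite /fe0 INR_odd.
set s := ((2 * INR m + 1) * t)%R.
have m0 := pos_INR m.
have hs : (0 <= s < 2 * INR m + 1)%R by rewrite /s; nra.
have := floor_natP (proj1 hs).
set j := Z.to_nat _ => hj.
have jm : j <= 2 * m.
  rewrite leqNgt; apply/negP => /INR_ltn.
  by rewrite -multE mult_INR /=; lra.
case: eqP => [j0 [<- ey]|j0].
  rewrite j0 /= in hj ey; split; [lia | lra | exists false; rewrite // /sg /=; lra].
have [r' er] : exists r', j = 2 * r' \/ j = 2 * r' + 1 by exists j./2; lia.
case: er => er.
  have -> : odd j = false by lia.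
  have -> : j %/ 2 = r' by lia.
  move=> [<- ey].
  have ej : INR j = (2 * INR r')%R by rewrite er -multE mult_INR.
  by split; [lia | lra | exists false; rewrite // /sg; lra].
have -> : odd j by lia.
have -> : j.+1 %/ 2 = r'.+1 by lia.
have ej : INR j = (2 * INR r' + 1)%R by rewrite er INR_odd.
case: (Req_dec_T _ _) => // u0 [<- ey].
by split; [lia | lra | exists true; rewrite // /sg S_INR; lra].
Qed.

Lemma fe0_0 m : fe0 m 0 = SE 0 0.
Proof.
rewrite /fe0 Rmult_0_r (@floor_nat 0 0) /=; last lra.
by congr SE; lra.
Qed.

(** * Local type of the truncated map at a point of [e_0] *)

Section LocalType.
Variables (n m r : nat) (lo : nat -> R) (l t0 y : R) (rev : bool).
Hypotheses (lo_r : lo r = l) (lo_0 : lo 0 = l) (lo_t0 : (l <= t0 < 1)%R).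
Hypotheses (l_gt0 : (0 < l)%R) (hy : (0 < y < 1)%R) (hr : rev -> 0 < r).
Hypothesis e0 : ((2 * INR m + 1) * t0 = 2 * INR r + sg rev * y)%R.

Let c := (2 * INR m + 1)%R.
Let c_ge1 : (1 <= c)%R. Proof. by have := pos_INR m; rewrite /c; lra. Qed.

Lemma trunc_near : exists2 d, (0 < d)%R & forall t, (t0 - d < t < t0 + d)%R ->
  trunc n m lo (SE 0 t) = SE r (Rmax l (y + sg rev * (c * (t - t0)))).
Proof.
(* Slope [c] turns this radius into the distance from [y] to the ends of the edge, so the image
   stays inside the open edge. *)
exists (Rmin y (1 - y) / c)%R.
  by apply: Rdiv_lt_0_compat; [apply: Rmin_glb_lt; lra | lra].
move=> t ht.
have hc : (- Rmin y (1 - y) < c * (t - t0) < Rmin y (1 - y))%R.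
  have -> : Rmin y (1 - y) = (c * (Rmin y (1 - y) / c))%R by field; lra.
  by nra.
have [h1 h2] := (Rmin_l y (1 - y), Rmin_r y (1 - y)).
rewrite /trunc /fstar eqxx.
rewrite (@fe0E m rev r t (y + sg rev * (c * (t - t0)))) //.
- rewrite lo_r; case: (Rlt_dec _ _) => h.
  + by rewrite Rmax_left //; lra.
  + by rewrite Rmax_right //; lra.
- by case: (rev); rewrite /sg; lra.
- by rewrite /c; move: e0; case: (rev); rewrite /sg; lra.
Qed.

(** When the image lies strictly above [p_r], the retraction does nothing near [t0], and the type is
    the sign of the slope. *)
Lemma loc_type_gt : (l < y)%R ->
  [/\ rev <-> loc_rev n m lo t0, ~~ rev <-> loc_pres n m lo t0
    & ~ loc_noninj n m lo t0].
Proof.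
move=> ly; have [d d0 H] := trunc_near.
pose d' := Rmin d ((y - l) / c).
have d'0 : (0 < d')%R.
  by apply: Rmin_glb_lt => //; apply: Rdiv_lt_0_compat; lra.
have [h1 h2] : (d' <= d /\ d' <= (y - l) / c)%R by split; [exact: Rmin_l | exact: Rmin_r].
have H' t : (t0 - d' < t < t0 + d')%R ->
    trunc n m lo (SE 0 t) = SE r (y + sg rev * (c * (t - t0))).
  move=> ht; rewrite H; last lra.
  rewrite Rmax_right //.
  have e : (y - l = c * ((y - l) / c))%R by field; lra.
  by case: (rev); rewrite /sg; nra.
(* Test points lie to the right of [t0], since [t0] may be the left end of the span of P in
   [e_0]. *)
have near e : (0 < e)%R -> exists t, (t0 < t < 1 /\ t < t0 + e /\ t < t0 + d')%R.
  move=> e0'; exists (t0 + Rmin (Rmin e d') (1 - t0) / 2)%R.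
  have h0 : (0 < Rmin (Rmin e d') (1 - t0))%R by do !apply: Rmin_glb_lt; lra.
  have := Rmin_l (Rmin e d') (1 - t0); have := Rmin_r (Rmin e d') (1 - t0).
  by have := Rmin_l e d'; have := Rmin_r e d'; lra.
have inj t1 t2 : (t1 < t2)%R -> (c * (t1 - t0) < c * (t2 - t0))%R by nra.
have xcl : ~~ (rev) -> loc_rev n m lo t0 -> False.
  move=> nr [e [e0' he]]; have [t [h3 [h4 h5]]] := near e e0'.
  have [|||||r' [u1 [u2 [e1 [e2 u12]]]]] := he t0 t; rewrite ?lo_0; try lra.
  move: e1 e2 u12; rewrite !H'; try lra.
  case=> _ <- [_ <-].
  have := inj _ _ (proj1 h3).
  by case: (rev) nr => // _; rewrite /sg; lra.
have xcl' : rev -> loc_pres n m lo t0 -> False.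
  move=> nr [e [e0' he]]; have [t [h3 [h4 h5]]] := near e e0'.
  have [|||||r' [u1 [u2 [e1 [e2 u12]]]]] := he t0 t; rewrite ?lo_0; try lra.
  move: e1 e2 u12; rewrite !H'; try lra.
  case=> _ <- [_ <-].
  have := inj _ _ (proj1 h3).
  by case: (rev) nr => // _; rewrite /sg; lra.
split.
- split=> [rv|lr]; last by case: (boolP rev) => // /xcl /(_ lr).
  exists d'; split=> // t1 t2 a1 a2 a3 a4 a5.
  exists r, (y + sg rev * (c * (t1 - t0)))%R, (y + sg rev * (c * (t2 - t0)))%R.
  rewrite !H'; try lra; split=> //; split=> //.
  by have := inj _ _ a2; rewrite rv /sg; lra.
- split=> [/negPf rv|lr]; last by apply/negP => /xcl' /(_ lr).
  exists d'; split=> // t1 t2 a1 a2 a3 a4 a5.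
  exists r, (y + sg rev * (c * (t1 - t0)))%R, (y + sg rev * (c * (t2 - t0)))%R.
  rewrite !H'; try lra; split=> //; split=> //.
  by have := inj _ _ a2; rewrite rv /sg; lra.
move=> /(_ d' d'0) [t1 [t2 [a1 [a2 [a3 [a4 [a5 e]]]]]]].
move: e; rewrite !H'; try lra; case.
by have := inj _ _ a2; case: (rev); rewrite /sg; lra.
Qed.

(* One of the two one-sided neighbourhoods of t0 is truncated to the point p_r. *)
Lemma loc_type_eq : l = y -> (l < t0)%R ->
  [/\ ~ loc_rev n m lo t0, ~ loc_pres n m lo t0 & loc_noninj n m lo t0].
Proof.
move=> ly lt0; have [d d0 H] := trunc_near.
have key : loc_noninj n m lo t0.
  move=> e e0'.
  pose w := (Rmin (Rmin e d) (Rmin (t0 - l) (1 - t0)) / 2)%R.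
  have w0 : (0 < w)%R.
    suff : (0 < Rmin (Rmin e d) (Rmin (t0 - l) (1 - t0)))%R by rewrite /w; lra.
    by do !apply: Rmin_glb_lt; lra.
  have [w1 w2] : (w < e /\ w < d)%R.
    have := Rmin_l (Rmin e d) (Rmin (t0 - l) (1 - t0)).
    by have := Rmin_l e d; have := Rmin_r e d; move: w0; rewrite /w; lra.
  have [w3 w4] : (w < t0 - l /\ w < 1 - t0)%R.
    have := Rmin_r (Rmin e d) (Rmin (t0 - l) (1 - t0)).
    by have := Rmin_l (t0 - l) (1 - t0); have := Rmin_r (t0 - l) (1 - t0); move: w0; rewrite /w; lra.
  have cw : (0 < c * w)%R by nra.
  (* The image drops below [p_r] to the right of [t0] on a reversing branch and to the left on a
     preserving one. *)
  case: (boolP rev) => rv.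
  - exists t0, (t0 + w)%R; repeat split; try lra.
    by rewrite !H; try lra; rewrite rv /sg !Rmax_left //; nra.
  - exists (t0 - w)%R, t0; repeat split; try lra.
    by rewrite !H; try lra; rewrite (negPf rv) /sg !Rmax_left //; nra.
split=> //.
  move=> [e [e0' he]]; have [t1 [t2 [a1 [a2 [a3 [a4 [a5 et]]]]]]] := key e e0'.
  have [|||||r' [u1 [u2 [e1 [e2 u12]]]]] := he t1 t2 => //.
  by move: e1; rewrite et e2 => -[]; lra.
move=> [e [e0' he]]; have [t1 [t2 [a1 [a2 [a3 [a4 [a5 et]]]]]]] := key e e0'.
have [|||||r' [u1 [u2 [e1 [e2 u12]]]]] := he t1 t2 => //.
by move: e1; rewrite et e2 => -[]; lra.
Qed.

End LocalType.

(** * Cyclic data and colours *)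

Definition label (n : nat) (D : data) (y : nat * nat) : bool :=
  (y.1 < n) && (y.2 < dN D y.1).

Lemma labelE n D r s : label n D (r, s) = (r < n) && (s < dN D r).
Proof. by []. Qed.

Section Cycle.
Variables (n m : nat) (D : data).
Let L := label n D.
Let K := card_orbit n D.
Let it j := iter j (dpi D) (m, 0).
Hypothesis L_closed : forall y, L y -> L (dpi D y).
Hypothesis L_m0 : L (m, 0).
Hypothesis L_reach : forall y, L y -> exists j, it j = y.
Hypothesis L_back : exists2 y, L y & dpi D y = (m, 0).

Lemma L_it j : L (it j).
Proof. by elim: j => [|j IH] //; apply: L_closed. Qed.

Definition all_labels : seq (nat * nat) :=
  [seq (r, s) | r <- iota 0 n, s <- iota 0 (dN D r)].

Lemma mem_all_labels y : (y \in all_labels) = L y.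
Proof.
apply/allpairsPdep/idP => [[r [s [hr hs ->]]]|/andP[h1 h2]].
  by move: hr hs; rewrite !mem_iota /L /label /= !add0n => -> ->.
by exists y.1, y.2; rewrite !mem_iota /= !add0n h1 h2; split=> //; case: (y).
Qed.

Lemma size_all_labels : size all_labels = K.
Proof.
rewrite size_allpairs_dep /K /card_orbit sumnE big_map -[X in iota 0 X]subn0.
rewrite [LHS]big_mkord.
by apply: eq_bigr => r _; rewrite size_iota.
Qed.

Lemma uniq_all_labels : uniq all_labels.
Proof.
apply: allpairs_uniq_dep => [|r _|]; rewrite ?iota_uniq //.
by move=> [r s] [r' s'] _ _ /= [-> ->].
Qed.

(** The least return time of [(m,0)] gives that many distinct labels, and they exhaust all labels;
    counting identifies it with [K]. This justifies [piinv] as an inverse iterate. *)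
Lemma cycle_period :
  [/\ 0 < K, it K = (m, 0) & forall i j, i < K -> j < K -> it i = it j -> i = j].
Proof.
have ex : exists c, (0 < c) && (it c == (m, 0)).
  have [y Ly ey] := L_back; have [j hj] := L_reach Ly.
  by exists j.+1; rewrite /= /it /= -/(it j) hj ey eqxx.
have [c /andP[c0 /eqP ec] min] := ex_minnP ex.
have it_inj i j : i < c -> j < c -> it i = it j -> i = j.
  wlog ij : i j / i <= j => [H hi hj e|hi hj e].
    by case: (leqP i j) => h; [exact: H | symmetry; apply: H => //; lia].
  have : c <= c - j + i \/ i = j; last by lia.
  case: (eqVneq i j) => [|ne]; [by right | left; apply: min].
  apply/andP; split; first lia.
  by rewrite /it iterD -/(it i) e /it -iterD subnK -/(it c) ?ec // ltnW.
have it_mod j : it j = it (j %% c).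
  rewrite {1}(divn_eq j c) /it addnC iterD; congr iter.
  by elim: (j %/ c) => // d IH; rewrite mulSn iterD IH -/(it c) ec.
suff <- : c = K by [].
rewrite -size_all_labels -[LHS](size_mkseq it).
apply: perm_size; apply: uniq_perm; [|exact: uniq_all_labels|].
  apply/(mkseq_uniqP it c) => i j; rewrite !inE; exact: it_inj.
move=> y; rewrite mem_all_labels; apply/mapP/idP => [[j _ ->]|]; first exact: L_it.
move=> /L_reach [j <-]; exists (j %% c); last exact: it_mod.
by rewrite mem_iota add0n ltn_mod.
Qed.

Lemma it_mod j : it j = it (j %% K).
Proof.
have [_ eK _] := cycle_period.
rewrite {1}(divn_eq j K) /it addnC iterD; congr iter.
by elim: (j %/ K) => // d IH; rewrite mulSn iterD IH -/(it K) eK.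
Qed.

Lemma it_small y : L y -> exists2 j, j < K & it j = y.
Proof.
move=> /L_reach [j ej]; have [K0 _ _] := cycle_period.
by exists (j %% K); rewrite -?it_mod // ltn_mod.
Qed.

Lemma dpi_inj y z : L y -> L z -> dpi D y = dpi D z -> y = z.
Proof.
move=> /it_small [i iK <-] /it_small [j jK <-]; rewrite -!iterS -!/(it _.+1).
have [K0 eK inj] := cycle_period.
rewrite (it_mod i.+1) (it_mod j.+1) => e.
have := inj _ _ (ltn_pmod i.+1 K0) (ltn_pmod j.+1 K0) e => {}e.
congr it.
have [h1|h1] : i.+1 = K \/ i.+1 < K by lia.
  have [h2|h2] : j.+1 = K \/ j.+1 < K by lia.
    by lia.
  by move: e; rewrite h1 modnn modn_small; lia.
have [h2|h2] : j.+1 = K \/ j.+1 < K by lia.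
  by move: e; rewrite h2 modnn modn_small; lia.
by move: e; rewrite !modn_small //; lia.
Qed.

Hypothesis it_base : forall j, j < n -> it j = (orbitn n m j.+1, 0).
Hypotheses (n_gt0 : 0 < n) (co : coprime m n).

Lemma L_base r : r < n -> L (r, 0).
Proof.
by move=> /(orbitn_surj n_gt0 co) [[|j] // hj <-]; rewrite -it_base ?L_it.
Qed.

Lemma card_orbit_ge : n <= K.
Proof.
rewrite /K /card_orbit -[n in n <= _]card_ord -sum1_card.
by apply: leq_sum => r _; have /andP[_] := L_base (ltn_ord r).
Qed.

Lemma piinv_it i : piinv n m D i = it (K - i).
Proof. by []. Qed.

Lemma piinvS i : i < K -> dpi D (piinv n m D i.+1) = piinv n m D i.
Proof. by move=> h; rewrite !piinv_it -iterS -subSn. Qed.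

Lemma piinv_inj i j : 0 < i <= K -> 0 < j <= K ->
  piinv n m D i = piinv n m D j -> i = j.
Proof.
move=> hi hj; have [_ _ inj] := cycle_period => e.
by have := inj (K - i) (K - j) _ _ e; lia.
Qed.

(** The base labels [(r,0)] are the iterates [0..n-1] of [(m,0)], hence [pi^{-i}(m,0)] with
    [K-n < i <= K]; the colouring covers exactly the other labels. *)
Lemma piinv_base i : 0 < i <= K - n -> (piinv n m D i).1 < n -> (piinv n m D i).2 != 0.
Proof.
move=> hi lt; apply/eqP => e.
have : exists2 j, j < n & it j = piinv n m D i.
  have [[|j] // hj ej] := orbitn_surj n_gt0 co lt.
  by exists j => //; rewrite it_base // ej -e; case: piinv.
move=> [j jn]; rewrite piinv_it; have [_ _ inj] := cycle_period.
by move=> /inj; lia.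
Qed.

Lemma piinv_ex y : L y -> y.2 != 0 -> exists2 i, 0 < i <= K - n & piinv n m D i = y.
Proof.
move=> /it_small [j jK <-] nz; exists (K - j); last first.
  by rewrite piinv_it subKn // ltnW.
suff : n <= j by lia.
by rewrite leqNgt; apply/negP => jn; move: nz; rewrite it_base.
Qed.

(** Indices in [1..K-n] are determined by their labels, so the existential in [in_beta] admits a
    single witness. *)
Lemma in_beta_piinv i : 0 < i <= K - n ->
  in_beta n m D (piinv n m D i) <-> colb n m D i.
Proof.
move=> hi; split=> [[j [hj [e c]]]|c]; last by exists i.
rewrite -/K in hj; have nK := card_orbit_ge.
by rewrite -(piinv_inj _ _ e) //; lia.
Qed.

Lemma in_alpha_piinv i : 0 < i <= K - n ->
  in_alpha n m D (piinv n m D i) <-> ~~ colb n m D i.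
Proof.
move=> hi; split=> [[j [hj [e c]]]|c]; last by exists i.
rewrite -/K in hj; have nK := card_orbit_ge.
by rewrite -(piinv_inj _ _ e) //; lia.
Qed.

Lemma in_beta_not_alpha y : L y -> y.2 != 0 -> in_beta n m D y <-> ~ in_alpha n m D y.
Proof.
move=> Ly nz; have [i hi <-] := piinv_ex Ly nz.
by rewrite in_beta_piinv // in_alpha_piinv //; split=> [-> //|/negP]; rewrite negbK.
Qed.

Lemma in_beta_back y : L y -> y.2 != 0 -> dpi D y = (m, 0) -> in_beta n m D y.
Proof.
move=> Ly nz e; have [i hi ey] := piinv_ex Ly nz.
suff i1 : i = 1 by rewrite -ey; apply/in_beta_piinv => //; rewrite i1.
have [K0 eK inj] := cycle_period.
apply: piinv_inj; try lia.
apply: dpi_inj; rewrite ?piinv_it; try exact: L_it.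
rewrite -!iterS -!/(it _.+1) (_ : (K - 1).+1 = K) ?eK; last lia.
by rewrite -e -ey.
Qed.

(** The recursion of [colb] freed from indices, so that colours can be carried along edges label by
    label. *)
Lemma in_beta_step y : L y -> y.2 != 0 -> (dpi D y).2 != 0 ->
  in_beta n m D y <-> (if flip D y then in_alpha n m D (dpi D y)
                       else in_beta n m D (dpi D y)).
Proof.
move=> Ly nz nz'; have [[//|i] hi ey] := piinv_ex Ly nz.
have e : dpi D y = piinv n m D i by rewrite -ey piinvS //; lia.
have i0 : 0 < i.
  case: (posnP i) => // i0; move: nz'; rewrite e i0 piinv_it subn0.
  by have [_ -> _] := cycle_period.
have hi' : 0 < i <= K - n by lia.
have [hb hb'] := (in_beta_piinv hi, in_beta_piinv hi').
have ha := in_alpha_piinv hi'.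
suff E : colb n m D i.+1 <-> (if flip D y then ~~ colb n m D i else colb n m D i).
  by rewrite e -{1}ey; case: flip E; tauto.
rewrite /= (_ : (i == 0) = false) ?ey; last lia.
by case: flip; case: colb.
Qed.

End Cycle.

(** * Periodic points with a given itinerary *)

Section Itinerary.
Variables (T : Type) (ret : T -> T) (c : nat) (m : nat) (e : T -> nat) (rev : T -> bool).
Hypotheses (c_gt0 : 0 < c) (ret_c : forall s, iter c ret s = s) (m_gt0 : 0 < m).
Hypotheses (e_le : forall s, e s <= m) (e_rev : forall s, rev s -> 0 < e s).

Let d := (2 * INR m + 1)%R.
Let d_ge3 : (3 <= d)%R.
Proof. by have := INR_ltn m_gt0; rewrite /d /=; lra. Qed.

Let branch s (y : R) := ((2 * INR (e s) + sg (rev s) * y) / d)%R.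

(* [branches s l] is the affine map [y |-> A + B y] composed of the l inverse
   branches met along s, ret s, ret (ret s), ... *)
Fixpoint branches s l : R * R :=
  if l is l'.+1 then
    let AB := branches (ret s) l' in (branch s AB.1, sg (rev s) * AB.2 / d)%R
  else (0, 1)%R.

Let app s l y := ((branches s l).1 + (branches s l).2 * y)%R.

Let appS s l y : app s l.+1 y = branch s (app (ret s) l y).
Proof. by rewrite /app /= /branch; field; lra. Qed.

Let appSr s l y : app s l.+1 y = app s l (branch (iter l ret s) y).
Proof.
elim: l s y => [|l IH] s y; first by rewrite /app /= /branch; field; lra.
by rewrite appS IH -iterSr -appS.
Qed.

Let branch01 s y : (0 <= y <= 1)%R -> (0 <= branch s y <= 1)%R.
Proof.
move=> hy; suff : (0 <= 2 * INR (e s) + sg (rev s) * y <= d)%R.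
  move=> h; have i0 : (0 < / d)%R by apply: Rinv_0_lt_compat; lra.
  have di : (d * / d = 1)%R by apply: Rinv_r; lra.
  by rewrite /branch /Rdiv; nra.
have := INR_leq (e_le s); have := pos_INR (e s); rewrite /d.
have := @e_rev s; case: (rev s) => [/(_ isT) /INR_ltn|_]; rewrite /sg /=; lra.
Qed.

Let app01 s l y : (0 <= y <= 1)%R -> (0 <= app s l y <= 1)%R.
Proof.
move=> hy; elim: l s => [|l IH] s; first by rewrite /app /=; lra.
by rewrite appS; apply: branch01.
Qed.

(** The slope is the difference of the values at 1 and 0, both of which lie in [[0,1]]. *)
Let slope_le1 s l : (-1 <= (branches s l).2 <= 1)%R.
Proof. by have := @app01 s l 0; have := @app01 s l 1; rewrite /app; lra. Qed.

Let slope_lt1 s l : 0 < l -> ((branches s l).2 < 1)%R.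
Proof.
case: l => // l _ /=; have := slope_le1 (ret s) l.
set z := (branches _ _).2 => hz.
have i3 : (0 < / d < 1)%R.
  split; first by apply: Rinv_0_lt_compat; lra.
  by rewrite -Rinv_1; apply: Rinv_lt_contravar; lra.
by rewrite /Rdiv; case: (rev s); rewrite /sg; nra.
Qed.

(** Composing the inverse branches over a period [c] gives an affine map of slope less than 1; the
    points are the unique fixed points of these maps. *)
Lemma itinerary_points : exists x : T -> R, forall s,
  (0 <= x s <= 1)%R /\ ((2 * INR m + 1) * x s = 2 * INR (e s) + sg (rev s) * x (ret s))%R.
Proof.
pose x s := ((branches s c).1 / (1 - (branches s c).2))%R.
have fix_x s : app s c (x s) = x s.
  by have := @slope_lt1 s c c_gt0; rewrite /app /x => h; field; lra.
have fix_uniq s y : app s c y = y -> y = x s.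
  have := @slope_lt1 s c c_gt0; rewrite /app /x => h e0.
  by apply: (Rmult_eq_reg_r (1 - (branches s c).2)); [field_simplify; lra | lra].
have x01 s : (0 <= x s <= 1)%R.
  have h := @slope_lt1 s c c_gt0; have h' := slope_le1 s c.
  have h0 := @app01 s c 0 ltac:(lra); have h1 := @app01 s c 1 ltac:(lra).
  rewrite /app in h0 h1.
  have e0 : ((1 - (branches s c).2) * x s = (branches s c).1)%R by rewrite /x; field; lra.
  by nra.
exists x => s; split=> //.
(* The branch at [s] intertwines the period map at [ret s] with the one at [s], so it carries one
   fixed point to the other. *)
have -> : x s = branch s (x (ret s)).
  symmetry; apply: fix_uniq.
  by have := appSr s c (x (ret s)); rewrite ret_c => <-; rewrite appS fix_x.
by rewrite /branch -/d; field; lra.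
Qed.

End Itinerary.

(** * The orbits P_{i,p/q,m/n} *)

(* The first-return map of P_{i,p/q,m/n} to e_0.  On {0, ..., q-1} it is the
   rotation s |-> s - p mod q, with the transition p -> 0 subdivided as p -> q -> 0;
   it is extended by the identity so as to be a permutation of nat. *)
Definition ret (p q s : nat) : nat :=
  if s < p then q - p + s
  else if s < q then if s == p then q else s - p
  else if s == q then 0 else s.

Lemma ret_le p q s : 0 < p < q -> s <= q -> ret p q s <= q.
Proof. by rewrite /ret => hpq h; do !case: ifP; lia. Qed.

Section Return.
Variables p q : nat.
Hypotheses (hpq : 0 < p < q) (copq : coprime p q).
Let sig := orbitn q (q - p).

Let q_gt0 : 0 < q. Proof. lia. Qed.
Let co' : coprime (q - p) q.
Proof.
move: copq; rewrite /coprime (gcdnC p) => /eqP <-; have /andP[_ /ltnW pq] := hpq.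
by rewrite -{2 3}(subnK pq) gcdnDl gcdnC [X in _ == X]gcdnC gcdnDr.
Qed.

Let ret_sig j : sig j != p -> ret p q (sig j) = sig j.+1.
Proof.
have lt : sig j < q := ltn_orbitn _ q_gt0 j.
rewrite /ret /sig orbitnS -/(sig j) => /negPf ne; rewrite lt ne.
case: ifP => h; first by rewrite modn_small; lia.
have -> : sig j + (q - p) = sig j - p + q by lia.
by rewrite modnDr modn_small; lia.
Qed.

(** Since [p + (q - p) = q], the rotation meets [p] just before closing up at time [q]. Hence [ret]
    follows the rotation through [0..q-1] and then inserts [q]. *)
Let sig_p j : 0 < j.+1 <= q -> (sig j == p) = (j.+1 == q).
Proof.
move=> hj; have lt : sig j < q := ltn_orbitn _ q_gt0 j.
apply/eqP/eqP => [e|e].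
  apply: (orbitn_eq0 q_gt0 co' hj).
  by rewrite orbitnS -/(sig j) e subnKC ?modnn; lia.
have : sig j.+1 = 0 by rewrite e /sig orbitn_n.
rewrite /sig orbitnS -/(sig j) => /eqP.
rewrite -/(dvdn _ _) => /dvdnP [[|[|z]] ez]; nia.
Qed.

Let iter_sig j : j < q -> iter j (ret p q) 0 = sig j.
Proof.
elim: j => [|j IH] hj; first by rewrite /sig /orbitn mul0n mod0n.
by rewrite iterS IH ?ret_sig ?sig_p //; lia.
Qed.

Let iter_q : iter q (ret p q) 0 = q.
Proof.
transitivity (ret p q (iter q.-1 (ret p q) 0)); first by rewrite -iterS prednK.
rewrite iter_sig; last lia.
have -> : sig q.-1 = p by apply/eqP; rewrite sig_p; lia.
by rewrite /ret ltnn eqxx; have -> : p < q by lia.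
Qed.

Let iter_qS : iter q.+1 (ret p q) 0 = 0.
Proof. by rewrite iterS iter_q /ret ltnn eqxx; have -> : (q < p) = false by lia. Qed.

Lemma ret_reach s : s <= q -> exists j, iter j (ret p q) 0 = s.
Proof.
rewrite leq_eqVlt => /orP[/eqP ->|lt]; first by exists q.
have [j hj ej] := orbitn_surj q_gt0 co' lt.
have [e|l] : j = q \/ j < q by lia.
  by exists 0; rewrite -ej e orbitn_n.
by exists j; rewrite iter_sig.
Qed.

Lemma ret_period s : iter q.+1 (ret p q) s = s.
Proof.
have [/ret_reach [j <-]|h] := leqP s q.
  by rewrite -iterD addnC iterD iter_qS.
have e : ret p q s = s.
  by rewrite /ret; do !case: ifP; lia.
by elim: q.+1 => // c IH; rewrite iterS IH.
Qed.

(** The number of steps to [p], the only orientation-reversing point, is the induction measure for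
    the position and order of the points. *)
Lemma ret_hits s : s <= q -> exists c, iter c (ret p q) s = p.
Proof.
move=> hs; have [j <-] := ret_reach hs.
have [l el] : exists l, iter l (ret p q) 0 = p by apply: ret_reach; lia.
(* With the [j] steps already taken, [j * q] more complete [j] periods of length [q + 1]. *)
exists (l + j * q); rewrite -iterD -addnA (addnC (j * q)) -mulnS iterD.
by rewrite -[RHS]el; congr iter; elim: (j) => // c IH; rewrite mulSn iterD IH iter_qS.
Qed.

End Return.

(** * The data [Pdata] expressed by times *)

Section PdataFormulas.
Variables n m i a b p q : nat.
Hypotheses (m_gt1 : 1 < m) (m_lt_n : m < n) (co : coprime m n).
Hypotheses (ab : 1 < a < b) (bn : b <= n).
Hypotheses (ea : orbitn n m a = kk n m i.+1) (eb : orbitn n m b = kk n m i).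
Hypotheses (hkk : kk n m i < kk n m i.+1 < m) (hpq : 0 < p < q).
Let E := orbitn n m.
Let D := Pdata n m i p q.
Let n_gt0 : 0 < n. Proof. lia. Qed.

Lemma pred_a : kk n m i.+1 + n - m = E a.-1.
Proof. by rewrite -ea orbitn_pred // ?ea; lia. Qed.

Lemma pred_b : kk n m i + n - m = E b.-1.
Proof. by rewrite -eb orbitn_pred // ?eb; lia. Qed.

Lemma Pdata_N j : 0 < j <= n ->
  dN D (E j) = if j < a then 1 else if j < b then q + 1 - p else q + 1.
Proof.
move=> hj; rewrite /D /Pdata /= pred_a pred_b.
have -> : insegb n m m (E a.-1) = insegb n m (E 1) (E a.-1) by rewrite /E orbitn1.
have -> : insegb n m (kk n m i) 0 = insegb n m (E b) (E n) by rewrite /E eb orbitn_n.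
rewrite -ea -/(E a) !(insegb_orbitnE n_gt0 co) //; try lia.
by do !case: ifP; lia.
Qed.

Lemma Pdata_pi j s : 0 < j < n ->
  dpi D (E j, s) = if (j.+1 == b) && (s == q - p) then (kk n m i, q) else (E j.+1, s).
Proof.
move=> hj; have nz : (E j == 0) = false.
  by apply/eqP => /(orbitn_eq0 n_gt0 co) e; lia.
rewrite /D /Pdata /= pred_b nz /= -orbitnS -/(E _).
suff -> : (E j == E b.-1) = (j.+1 == b) by [].
apply/eqP/eqP => [/(orbitn_inj n_gt0 co) e|e]; last by congr E; lia.
by have := e ltac:(lia) ltac:(lia); lia.
Qed.

Lemma Pdata_pi0 s : s <= q ->
  dpi D (0, s) = if s < p then (kk n m i, q - p + s)
                 else if s == p then (kk n m i.+1, q - p)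
                 else if s < q then (kk n m i.+1, s - p) else (m, 0).
Proof.
move=> h; rewrite /D /Pdata /=; case: (ltngtP s p) => //= sp.
by case: (ltngtP s q) h.
Qed.

End PdataFormulas.

(** * Existence: realising [Pdata] by a star orbit *)

Section Realisation.
Variables n m i a b p q : nat.
Hypotheses (m_gt1 : 1 < m) (m_lt_n : m < n) (co : coprime m n).
Hypotheses (ab : 1 < a < b) (bn : b <= n).
Hypotheses (ea : orbitn n m a = kk n m i.+1) (eb : orbitn n m b = kk n m i).
Hypotheses (hkk : kk n m i < kk n m i.+1 < m) (hpq : 0 < p < q).
Local Notation E := (orbitn n m).
Let D := Pdata n m i p q.
Let k := kk n m i.
Let k' := kk n m i.+1.
Let L := label n D.
Let n_gt0 : 0 < n. Proof. lia. Qed.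
Let pq : p < q. Proof. by case/andP: hpq. Qed.
Let E_n : E n = 0 := orbitn_n n m.

Let edge s := if s < p then k else if s < q then k' else m.
Local Notation rt := (ret p q).

(* The index of the point of P in e_0 at which the point labelled (r,s) first
   arrives in e_0. *)
Definition arrival (r s : nat) : nat :=
  if insegb n m k' (k + n - m) r && (s == q - p) then q else s.

Let NE j : 0 < j <= n ->
  dN D (E j) = if j < a then 1 else if j < b then q + 1 - p else q + 1.
Proof. by move=> hj; eapply Pdata_N; eassumption. Qed.

Let piE j s : 0 < j < n ->
  dpi D (E j, s) = if (j.+1 == b) && (s == q - p) then (k, q) else (E j.+1, s).
Proof. by move=> hj; eapply Pdata_pi; eassumption. Qed.

Let pi0E s : s <= q ->
  dpi D (0, s) = if s < p then (k, q - p + s)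
                 else if s == p then (k', q - p)
                 else if s < q then (k', s - p) else (m, 0).
Proof. by move=> hs; eapply Pdata_pi0; eassumption. Qed.

Let pred_b : k + n - m = E b.-1.
Proof. by eapply pred_b; eassumption. Qed.

Lemma arrivalE j s : 0 < j <= n ->
  arrival (E j) s = if (a <= j < b) && (s == q - p) then q else s.
Proof.
move=> hj; rewrite /arrival pred_b -/k' /k' -ea.
by rewrite (insegb_orbitnE n_gt0 co) //; try lia; congr (if (_ && _) then _ else _); lia.
Qed.

Lemma arrival0 s : arrival 0 s = s.
Proof. by rewrite -E_n arrivalE; [case: ifP => //; lia | lia]. Qed.

Lemma arrival_base r : r < n -> arrival r 0 = 0.
Proof.
move=> /(orbitn_surj n_gt0 co) [j hj <-]; rewrite arrivalE //.
by case: ifP => //; lia.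
Qed.

Lemma arrival_le r s : L (r, s) -> arrival r s <= q.
Proof.
rewrite /L labelE => /andP[/(orbitn_surj n_gt0 co) [j hj <-]]; rewrite NE // arrivalE //.
by do !case: ifP; lia.
Qed.

(** On an edge of S the label redirected to [q] is [q - p], the top one, so the order survives. *)
Lemma arrival_mono r s s' : L (r, s') -> s < s' -> arrival r s < arrival r s'.
Proof.
rewrite /L labelE => /andP[/(orbitn_surj n_gt0 co) [j hj <-]]; rewrite NE // !arrivalE //.
by do !case: ifP; lia.
Qed.

Lemma N0 : dN D 0 = q + 1.
Proof. by rewrite -E_n NE; [do !case: ifP; lia | lia]. Qed.

(** The arrival index is constant off [e_0] and changes by [ret] on leaving [e_0]: the data is a
    tower over the return map. *)
Lemma Pdata_step r s : L (r, s) -> let z := dpi D (r, s) in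
  [/\ L z, z.1 = (if r == 0 then edge s else (r + m) %% n)
    & arrival z.1 z.2 = if r == 0 then rt s else arrival r s].
Proof.
rewrite /L labelE => /andP[/(orbitn_surj n_gt0 co) [j hj <-]].
have [jn|jn] : j = n \/ j < n by lia.
  rewrite jn E_n eqxx N0 => sq; rewrite pi0E; last lia.
  have La r' : r' < n -> L (r', 0).
    move=> lt; rewrite /L labelE lt; case: (orbitn_surj n_gt0 co lt) => l hl <-.
    by rewrite NE //; do !case: ifP; lia.
  have Lb s0 : s0 < q + 1 -> L (k, s0).
    move=> lt; rewrite /L labelE /k -eb NE; last lia.
    by rewrite ltn_orbitn //; do !case: ifP; lia.
  have Lc s0 : s0 < q + 1 - p -> L (k', s0).
    move=> lt; rewrite /L labelE /k' -ea NE; last lia.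
    by rewrite ltn_orbitn //; do !case: ifP; lia.
  have Ab s0 : arrival k s0 = s0.
    by rewrite /k -eb arrivalE; [case: ifP => //; lia | lia].
  have Aa s0 : arrival k' s0 = if s0 == q - p then q else s0.
    by rewrite /k' -ea arrivalE; [do !case: ifP => //; lia | lia].
  rewrite /edge /ret; case: (ltngtP s p) => sp /=.
  - by split; [apply: Lb; lia | | rewrite Ab].
  - case: (ltngtP s q) => sq' /=.
    + by split; [apply: Lc; lia | | rewrite Aa; case: ifP; lia].
    + lia.
    + by split; [apply: La | | rewrite arrival_base].
  - have -> : s < q by lia.
    by split; [apply: Lc; lia | | rewrite Aa eqxx].
have nz : (E j == 0) = false.
  by apply/eqP => /(orbitn_eq0 n_gt0 co) e; lia.
rewrite nz NE // => sN; rewrite piE ?hj //; last lia.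
rewrite -orbitnS; case: ifP => [/andP[/eqP jb /eqP ss]|ne] /=.
  rewrite -/k /k -eb -jb !arrivalE; try lia.
  split=> //; last by do !case: ifP; lia.
  by rewrite /L labelE ltn_orbitn // NE; [do !case: ifP; lia | lia].
rewrite !arrivalE; try lia.
split=> //; last by move: ne sN; do !case: ifP; lia.
rewrite /L labelE ltn_orbitn // NE; last lia.
by move: ne sN; do !case: ifP; lia.
Qed.

Lemma Pdata_step_eq r s r' s' : L (r, s) -> dpi D (r, s) = (r', s') ->
  [/\ L (r', s'), r' = (if r == 0 then edge s else (r + m) %% n)
    & arrival r' s' = if r == 0 then rt s else arrival r s].
Proof. by move=> /Pdata_step + e; rewrite e. Qed.

Lemma L_closed y : L y -> L (dpi D y).
Proof. by case: y => r s /Pdata_step []. Qed.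

Lemma L_base0 r : r < n -> L (r, 0).
Proof.
move=> lt; rewrite /L labelE lt; case: (orbitn_surj n_gt0 co lt) => l hl <-.
by rewrite NE //; do !case: ifP; lia.
Qed.

Lemma it_base j : j < n -> iter j (dpi D) (m, 0) = (orbitn n m j.+1, 0).
Proof.
elim: j => [|j IH] hj; first by rewrite orbitn1.
rewrite iterS IH ?piE; try lia.
by case: ifP => //; lia.
Qed.

Lemma reach_arrival r s : L (r, s) -> exists c, iter c (dpi D) (r, s) = (0, arrival r s).
Proof.
move=> Ly; have := Ly; rewrite /L labelE => /andP[lt _].
have [j hj ej] := orbitn_surj n_gt0 co lt.
elim: {j}(n - j) {-2}j (leqnn (n - j)) r s Ly lt hj ej => [|d IH] j hd r s Ly lt hj ej.
  exists 0; have e : j = n by lia.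
  by rewrite -ej e E_n arrival0.
have [r0|r0] := eqVneq r 0; first by exists 0; rewrite r0 arrival0.
case ez: (dpi D (r, s)) => [r' s']; have [Lz e1 e2] := Pdata_step_eq Ly ez.
rewrite (negPf r0) in e1 e2.
have jn : j <> n by move=> e; move: r0; rewrite -ej e E_n.
have [c hc] := IH j.+1 ltac:(lia) r' s' Lz (proj1 (andP Lz)) ltac:(lia) ltac:(by rewrite e1 orbitnS ej).
by exists c.+1; rewrite iterSr ez hc e2.
Qed.

Hypothesis copq : coprime p q.
Hypothesis late : forall j, 0 < j <= n -> kk n m i < orbitn n m j < m -> j <= a.

(** * Points with the prescribed itinerary: order, colours and the conditions defining TT *)

Section Points.
Variable x : nat -> R.
Hypothesis hx : forall s, (0 <= x s <= 1)%R /\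
  ((2 * INR m + 1) * x s = 2 * INR (edge s) + sg (s == p) * x (rt s))%R.

Let hk : (INR k + 1 <= INR k')%R /\ (INR k' + 1 <= INR m)%R.
Proof. by have /andP[h1 h2] := hkk; split; apply: INR_ltn. Qed.

(** An end value 0 or 1 would pass from [x s] to [x (rt s)] and so on up to [p]. There the branch
    runs over [e_k'] with [0 < k' < m] and avoids both ends. *)
Lemma x_interior s : s <= q -> (0 < x s < 1)%R.
Proof.
move=> hs; have [x01 _] := hx s.
suff [h0 h1] : x s <> 0%R /\ x s <> 1%R by lra.
suff H : ~ (x s = 0 \/ x s = 1)%R by split=> h; apply: H; auto.
have [c] := ret_hits hpq copq hs.
elim: c s {hs x01} => [|c IH] s.
  move=> /= -> H; have [_] := hx p; have [h1 h2] := hk.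
  have [h3 _] := hx (rt p); have h4 := pos_INR k.
  by rewrite /edge ltnn pq eqxx /sg; case: H => -> ?; lra.
have [hk1 hk2] := hk; have k0 := pos_INR k; have e0 := pos_INR (edge s).
have edge_le : (INR (edge s) <= INR m)%R by rewrite /edge; do !case: ifP => _; lra.
rewrite iterSr => /IH H hs; apply: H.
have [h3 _] := hx (rt s); have [_] := hx s.
case: eqP => [sp|_]; rewrite /sg => h4; last by case: hs => e; rewrite e in h4; [left | right]; lra.
have es : edge s = k' by rewrite sp /edge ltnn pq.
by rewrite es in h4; case: hs => e; rewrite e in h4; [left | right]; lra.
Qed.

Lemma x_mono s s' : s < s' -> s' <= q -> (x s < x s')%R.
Proof.
move=> ss' s'q; have [c] : exists c, iter c rt s = p.
  by apply: (ret_hits hpq copq); lia.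
have [hk1 hk2] := hk; have m0 := pos_INR m.
(* These are the pairs on different branches; along [e_0] the pieces come in the order [e_k],
   reversed [e_k'], [e_k'], [e_m]. *)
have far u v : u < v -> v <= q -> (p <= u) || (p <= v) ->
    [|| u <= p, q <= u | q <= v] -> (x u < x v)%R.
  move=> uv vq h1 h2; have [_ eu] := hx u; have [_ ev] := hx v.
  have xu : (0 < x (rt u) < 1)%R by apply/x_interior/ret_le; lia.
  have xv : (0 < x (rt v) < 1)%R by apply/x_interior/ret_le; lia.
  suff : ((2 * INR m + 1) * x u < (2 * INR m + 1) * x v)%R by nra.
  rewrite eu ev /edge; move: h1 h2.
  case: (ltngtP u p) => cu; case: (ltngtP v p) => cv; try lia;
  case: (ltnP u q) => du; case: (ltnP v q) => dv; try lia;
  rewrite /sg => _ _; lra.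
elim: c s s' ss' s'q => [|c IH] s s' ss' s'q.
  by move=> /= sp; apply: far; lia.
rewrite iterSr => hc.
have [|near] := boolP (((p <= s) || (p <= s')) && [|| s <= p, q <= s | q <= s']).
  by case/andP; exact: far.
have [e1 e2 e3] : [/\ edge s = edge s', (s == p) = false & (s' == p) = false].
  by split; rewrite /edge; do ?case: ifP; lia.
(* A pair on a common branch keeps its order under [rt] and is one step closer to [p]. *)
have rr : rt s < rt s' by rewrite /ret; do !case: ifP; lia.
have := IH _ _ rr (ret_le hpq s'q) hc.
have [_] := hx s; have [_] := hx s'; rewrite e1 e2 e3 /sg.
by nra.
Qed.


Let reached y := exists j, iter j (dpi D) (m, 0) = y.

Let reached_iter c y z : reached y -> iter c (dpi D) y = z -> reached z.
Proof. by move=> [j <-] <-; exists (c + j); rewrite iterD. Qed.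

Lemma reach_e0 s : s <= q -> reached (0, s).
Proof.
move=> hs; have [c <-] := ret_reach hpq copq hs.
elim: c {hs} => [|c IH]; rewrite ?iterS.
  by exists n.-1; rewrite it_base; [rewrite prednK // orbitn_n | lia].
move: IH; set u := iter c rt 0 => IH.
have [hu|big] := leqP u q; last first.
  have -> // : rt u = u.
  by rewrite /ret; do !case: ifP; lia.
have Lu : L (0, u) by rewrite /L labelE N0; lia.
have [c' hc'] : exists c, iter c (dpi D) (dpi D (0, u)) = (0, rt u).
  case ez: (dpi D (0, u)) => [r' s']; have [Lz _ e2] := Pdata_step_eq Lu ez.
  by rewrite eqxx in e2; rewrite -e2; apply: reach_arrival.
by apply: (@reached_iter c'.+1 _ _ IH); rewrite iterSr.
Qed.

(** Induction on the time of the edge. A nonbase label comes from the preceding edge, except that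
    all those of [e_k'] (time [a]) and the labels [q-p..q-1] of [e_k] (time [b]) come from [e_0]. *)
Lemma L_reach y : L y -> reached y.
Proof.
case: y => r s Ly; have := Ly; rewrite /L labelE => /andP[lt].
have [j hj <-] := orbitn_surj n_gt0 co lt.
have from0 s' z : s' <= q -> dpi D (0, s') = z -> reached z.
  by move=> h e; apply: (@reached_iter 1 _ _ (reach_e0 h)).
elim: j s hj {r Ly lt} => [//|j IH] s hj; rewrite NE //.
have [->|s0] := posnP s.
  by exists j; rewrite it_base //; lia.
have [lt|] := ltnP j.+1 a; first lia.
rewrite leq_eqVlt => /orP[/eqP ja|lt].
  have -> : j.+1 < b by lia.
  move=> sN; rewrite -ja; have {}sN : s <= q - p by lia.
  have [e|ne] := eqVneq s (q - p).
    by apply: (from0 p); [lia | rewrite pi0E ?ltnn ?eqxx ?e ?ea //; lia].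
  apply: (from0 (s + p)); first lia.
  rewrite pi0E; last lia.
  by rewrite ea; do !(case: ifP => ?); try lia; congr (_, _); lia.
have prev s' : s' < dN D (E j) -> dpi D (E j, s') = (E j.+1, s) -> reached (E j.+1, s).
  by move=> h e; apply: (@reached_iter 1 _ _ (IH s' _ h)) => //; lia.
have Nj := @NE j ltac:(lia).
have [lt'|] := ltnP j.+1 b.
  move=> sN; apply: (prev s); first by rewrite Nj; do !case: ifP; lia.
  by rewrite piE; [case: ifP => //; lia | lia].
rewrite leq_eqVlt => /orP[/eqP jb|lt'] sN; last first.
  apply: (prev s); first by rewrite Nj; do !case: ifP; lia.
  by rewrite piE; [case: ifP => //; lia | lia].
have ek : E j.+1 = k by rewrite -jb.
have [e|ne] := eqVneq s q.
  apply: (prev (q - p)); first by rewrite Nj; do !case: ifP; lia.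
  by rewrite piE; [rewrite -jb !eqxx eb e | lia].
have [small|large] := ltnP s (q - p).
  apply: (prev s); first by rewrite Nj; do !case: ifP; lia.
  by rewrite piE; [case: ifP => //; lia | lia].
rewrite ek; apply: (from0 (s - (q - p))); first lia.
rewrite pi0E; last lia.
have -> : s - (q - p) < p by lia.
by congr (_, _); lia.
Qed.

Lemma L_back : exists2 y, L y & dpi D y = (m, 0).
Proof.
exists (0, q); first by rewrite /L labelE N0; lia.
by rewrite pi0E // ltnn; do !(case: ifP => ? //); lia.
Qed.

Let K := card_orbit n D.
Let L_m0 : L (m, 0) := L_base0 m_lt_n.
Let piinv_L j : L (piinv n m D j) := L_it L_closed L_m0 (K - j).

(** Colours are beta exactly for arrival at [q]. For [s < q] one has [rt s = q] only at [s = p], the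
    only point of A, so the flip there cancels beta and leaves every such [(0,s)] in alpha. *)
Lemma colb_arrival j : 0 < j <= K - n ->
  colb n m D j = (arrival (piinv n m D j).1 (piinv n m D j).2 == q).
Proof.
have [K0 eK _] := cycle_period L_closed L_m0 L_reach L_back.
elim: j => [//|j IH] hj.
have [j0|j0] := posnP j.
  suff -> : piinv n m D j.+1 = (0, q) by rewrite j0 arrival0 eqxx.
  apply: (dpi_inj L_closed L_m0 L_reach L_back) => //.
    by rewrite -/L /L labelE N0; lia.
  rewrite piinvS -/K; last lia.
  rewrite j0 piinv_it subn0 -/K eK pi0E //.
  by rewrite ltnn; do !(case: ifP => ? //); lia.
rewrite /= (_ : (j == 0) = false); last lia.
have e : dpi D (piinv n m D j.+1) = piinv n m D j.
  by apply: piinvS; rewrite -/K; lia.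
have nz : (piinv n m D j).2 != 0.
  apply: (piinv_base L_closed L_m0 L_reach L_back it_base n_gt0 co); first by rewrite -/K; lia.
  by have /andP[] := piinv_L j.
rewrite IH; last lia.
move: (piinv_L j.+1) nz e (Pdata_step (piinv_L j.+1)).
case: (piinv n m D j.+1) => r s Lrs nz e.
rewrite e => -[_ _ ->]; rewrite /flip /=.
have [r0|r0] := eqVneq r 0; last by case: (_ == q).
rewrite r0 arrival0 /=; rewrite r0 in Lrs e.
have sq : s <= q by move: Lrs; rewrite /L labelE N0; lia.
have snq : s != q.
  apply/eqP => sq'; move: nz; rewrite -e sq' pi0E // ltnn.
  by do !(case: ifP => ? //); lia.
rewrite /D /Pdata /= /ret; do !case: ifP; lia.
Qed.

Lemma in_beta_arrival r s : L (r, s) -> s != 0 -> arrival r s = q -> in_beta n m D (r, s).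
Proof.
move=> Ly s0 e; have [j hj ej] :=
  piinv_ex L_closed L_m0 L_reach L_back it_base n_gt0 co Ly s0.
rewrite -ej; apply/(in_beta_piinv L_closed L_m0 L_reach L_back it_base n_gt0 co) => //.
by rewrite colb_arrival // ej /= e.
Qed.

Lemma in_alpha_arrival r s : L (r, s) -> s != 0 -> arrival r s != q -> in_alpha n m D (r, s).
Proof.
move=> Ly s0 e; have [j hj ej] :=
  piinv_ex L_closed L_m0 L_reach L_back it_base n_gt0 co Ly s0.
rewrite -ej; apply/(in_alpha_piinv L_closed L_m0 L_reach L_back it_base n_gt0 co) => //.
by rewrite colb_arrival // ej.
Qed.

(** As [f] is isometric off [e_0], a point has the parameter with which it arrives in [e_0]. *)
Let lab (r s : nat) : R := x (arrival r s).
Let x00 := x_interior (leq0n q).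

Lemma fstar_lab r s : L (r, s) ->
  fstar n m (SE r (lab r s)) = SE (dpi D (r, s)).1 (lab (dpi D (r, s)).1 (dpi D (r, s)).2).
Proof.
move=> Ly; case ez: (dpi D (r, s)) => [r' s']; have [_ e1 e2] := Pdata_step_eq Ly ez.
rewrite {2}/lab [(r', s').1]/= [(r', s').2]/= e2 e1 /fstar; case: eqP => [r0|//].
rewrite r0 /lab arrival0 in Ly *.
have sq : s <= q by move: Ly; rewrite /L labelE N0; lia.
have [_ es] := hx s.
apply: fe0E es; last by apply/x_interior/ret_le.
by rewrite /edge => /eqP ->; rewrite ltnn pq; lia.
Qed.

Let x_start := SE m (lab m 0).

Lemma iter_fstar_lab j :
  iter j (fstar n m) x_start =
  SE (iter j (dpi D) (m, 0)).1 (lab (iter j (dpi D) (m, 0)).1 (iter j (dpi D) (m, 0)).2).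
Proof.
elim: j => [//|j IH]; rewrite !iterS IH fstar_lab -?surjective_pairing //.
exact: (L_it L_closed L_m0 j).
Qed.

Lemma orbit_of_lab y :
  orbit_of n m x_start y <-> exists r s, r < n /\ s < dN D r /\ y = SE r (lab r s).
Proof.
split=> [[j ->]|[r [s [hr [hs ->]]]]].
  rewrite iter_fstar_lab; have := L_it L_closed L_m0 j.
  case: (iter _ _ _) => r s; rewrite /= => Ly; exists r, s.
  by move: Ly; rewrite /L labelE => /andP[].
have Ly : L (r, s) by rewrite /L labelE hr hs.
by have [j ej] := L_reach Ly; exists j; rewrite iter_fstar_lab ej.
Qed.

Lemma lab_mono (r s s' : nat) : L (r, s') -> s < s' -> (lab r s < lab r s')%R.
Proof. by move=> Ly ss'; apply: x_mono; [exact: arrival_mono | exact: arrival_le]. Qed.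

Lemma nearest_lab r t : r < n -> nearest n m x_start r t -> t = x 0.
Proof.
move=> hr [/orbit_of_lab [r' [s [_ [hs [er ->]]]]]]; rewrite -{}er in hs * => min.
have [->|s0] := posnP s; first by rewrite /lab arrival_base.
have : (lab r s <= lab r 0)%R.
  apply/min/orbit_of_lab; exists r, 0; split=> //; split=> //.
  by have := L_base0 hr; rewrite /L labelE hr.
by have := @lab_mono r 0 s _ s0; rewrite /L labelE hr => /(_ hs); lra.
Qed.

Lemma star_orbit_start : star_orbit n m x_start.
Proof.
have Lorb r s : L (r, s) -> orbit_of n m x_start (SE r (lab r s)).
  by rewrite /L labelE => /andP[hr hs]; apply/orbit_of_lab; exists r, s.
have [K0 eK _] := cycle_period L_closed L_m0 L_reach L_back.
have L00 := L_base0 n_gt0.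
split; [|split; [|split; [|split]]].
- split.
    by have := x00; rewrite /x_start /lab /= arrival_base //; split=> //; lra.
  by exists K; split=> //; rewrite iter_fstar_lab eK.
- by exists (SE 0 (lab 0 0)); split=> //; apply: Lorb.
- by move=> r hr; exists (lab r 0); apply/Lorb/L_base0.
- exists (lab 0 0); split; first exact: Lorb.
  case e: (dpi D (0, 0)) => [r s]; have := fstar_lab L00; rewrite e => ->; split=> // u [].
  have [_ + _] := Pdata_step_eq L00 e; rewrite eqxx /edge.
  have -> : 0 < p by lia.
  by move=> -> km; move: hkk; rewrite -/k km; lia.
- move=> r t t' /andP[r0 hr] /(nearest_lab hr) -> /nearest_lab -> //; last first.
    exact: ltn_pmod.
  by rewrite /fstar; case: eqP => // r0'; rewrite r0' in r0.
Qed.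

Lemma has_data_Pdata : has_data n m x_start D.
Proof.
have Lrs r s : r < n -> s < dN D r -> L (r, s) by rewrite /L labelE => -> ->.
exists lab; split; [|split; [|split; [|split]]].
- move=> r s hr /(Lrs r s hr) Ly.
  by have := x_interior (arrival_le Ly); rewrite -/(lab r s); lra.
- by move=> r s s' hr ss' /(Lrs r s' hr) Ly; exact: lab_mono.
- exact: orbit_of_lab.
- move=> r s hr /(Lrs r s hr) Ly; case e: (dpi D (r, s)) => [r' s'].
  have [] := Pdata_step_eq Ly e; rewrite /L labelE => /andP[h1 h2] _ _.
  by split=> //; split=> //; have := fstar_lab Ly; rewrite e.
move=> s; rewrite N0 => sq.
have sq' : s <= q by lia.
have hlo r : r < n -> lab r 0 = x 0 by move=> hr; rewrite /lab arrival_base.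
have edge_n : edge s < n by rewrite /edge; do !case: ifP; move: hkk; rewrite -/k -/k'; lia.
have ex0 : lab 0 s = x s by rewrite /lab arrival0.
have hs01 : (x 0 <= x s < 1)%R.
  have := x_interior sq'; case: (posnP s) => [->|s0]; first by lra.
  by have := x_mono s0 sq'; lra.
have hy := x_interior (ret_le hpq sq').
have hrev : s == p -> 0 < edge s.
  by move=> /eqP ->; rewrite /edge ltnn pq; lia.
have [_ es] := hx s; rewrite ex0.
have l0 := proj1 x00.
rewrite /D /Pdata [dA _ _]/= [dB _ _]/= [dC _ _]/=.
(* Only [q] lands on a nearest point, namely [p_m]; this makes it the single point of class C. *)
have [eq|ne] := eqVneq s q.
  have er : rt s = 0 by rewrite eq /ret ltnn eqxx; case: ifP => //; lia.
  have sp : (s == p) = false by lia.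
  have lt : (x 0 < x s)%R by apply: x_mono; lia.
  have ly : x 0 = x (rt s) by rewrite er.
  have [h1 h2 h3] := loc_type_eq n (lo := fun r => lab r 0) (hlo _ edge_n)
    (hlo _ n_gt0) hs01 l0 hy hrev es ly lt.
  have -> : (s < q) = false by lia.
  by rewrite sp; split; [|split]; split=> // _; rewrite eq.
have lt : (x 0 < x (rt s))%R.
  apply: x_mono; last exact: ret_le.
  by rewrite /ret; do !case: ifP; lia.
have [h1 h2 h3] := loc_type_gt n (lo := fun r => lab r 0) (hlo _ edge_n)
  (hlo _ n_gt0) hs01 l0 hy hrev es lt.
have -> : s < q by lia.
by split; [|split].
Qed.

Lemma inTT_points : inTT n m k cB D.
Proof.
have Lrs r s : r < n -> s < dN D r -> L (r, s) by rewrite /L labelE => -> ->.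
exists x_start; split; [exact: star_orbit_start | split; first exact: has_data_Pdata].
have e00 : dpi D (0, 0) = (k, q - p) by rewrite pi0E // addn0; have -> : 0 < p by lia.
split; first by rewrite e00.
split; first by rewrite /D /=; lia.
split; [|split; [|split]].
- rewrite N0 => s sq; have Ly : L (0, s) by apply: Lrs; rewrite ?N0; lia.
  case e: (dpi D (0, s)) => [r' s']; have [Lz _ ez] := Pdata_step_eq Ly e.
  have nz : s' != 0.
    have := e; rewrite pi0E; last lia.
    by do !(case: ifP => ?); case=> _ <-; lia.
  rewrite eqxx in ez; rewrite /D /Pdata [dA _ _]/= [dB _ _]/= -/D; split=> [/andP[_ sp]|sp].
    by apply: in_alpha_arrival => //; rewrite ez /ret; do !case: ifP; lia.
  by apply: in_beta_arrival => //; rewrite ez /ret (eqP sp) ltnn pq eqxx.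
- move=> r hr; have [j hj ej] := @orbitn_surj n m n_gt0 co r ltac:(move: hkk; lia).
  have j1 : j <> 1 by move=> j1; move: hr; rewrite -ej j1 orbitn1 //; lia.
  have ja : j <= a by apply: late; rewrite // ej -/k.
  rewrite -ej orbitn_pred ?ej //; try lia.
  by rewrite NE; [case: ifP => //; lia | lia].
(* Only the top point of [e_{k+n-m}] goes above [pi(0,0) = (k,q-p)]: it is sent to [(k,q)], which
   arrives at [q]. *)
- rewrite pred_b e00 => s s0 sN; rewrite piE; last lia.
  have sN' : s < q + 1 - p by move: sN; rewrite NE; [do !case: ifP; lia | lia].
  have Lk : L (k, q).
    apply: Lrs; first by move: hkk; rewrite -/k; lia.
    by rewrite /k -eb NE; [do !case: ifP; lia | lia].
  case: ifP => [_ _|h /= lt]; last by lia.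
  apply: in_beta_arrival => //; first lia.
  by rewrite /k -eb arrivalE; [case: ifP | lia].
- by [].
Qed.

End Points.

Lemma inTT_Pdata : inTT n m k cB D.
Proof.
have [|||||x hx] := @itinerary_points nat rt q.+1 m edge (fun s => s == p).
- by [].
- exact: ret_period.
- exact: ltnW.
- by move=> s; rewrite /edge; move: hkk; rewrite -/k -/k'; do !case: ifP; lia.
- by move=> s /eqP ->; rewrite /edge ltnn pq; lia.
exact: inTT_points hx.
Qed.

End Realisation.

(** * Classification *)

(** Used to read off labels: once the order of the points entering an edge is known and all its
    labels are hit, no choice is left. *)
Lemma strict_onto_id (f : nat -> nat) M M' :
  (forall t t', t < t' -> t' < M -> f t < f t') ->
  (forall t, t < M -> f t < M') ->
  (forall s, s < M' -> exists2 t, t < M & f t = s) ->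
  M = M' /\ forall t, t < M -> f t = t.
Proof.
move=> inc into onto.
have fid t : t < M -> f t = t.
  elim: t {-2}t (leqnn t) => [|d IH] t td tM.
    have [u uM fu] : exists2 u, u < M & f u = 0 by apply: onto; have := into t tM; lia.
    have t0 : t = 0 by lia.
    by case: (posnP u) => u0; [rewrite t0 -{1}u0 | have := inc t u; lia].
  have [ft|ft|//] := ltngtP (f t) t.
    by have := IH (f t) ltac:(lia) ltac:(lia); have := inc (f t) t ft tM; lia.
  have [u uM fu] : exists2 u, u < M & f u = t by apply: onto; have := into t tM; lia.
  have [ut|ut|ut] := ltngtP u t; last by rewrite ut in fu; lia.
    by have := IH u ltac:(lia) uM; lia.
  by have := inc t u ut uM; lia.
split=> //; apply/eqP; rewrite eqn_leq; apply/andP; split.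
  case: (posnP M) => [-> //|M0].
  by have := into M.-1; rewrite fid; lia.
rewrite leqNgt; apply/negP => /onto [u uM].
by rewrite fid //; lia.
Qed.

(** Induction from the bottom gives [t <= f t]; induction from the top [M - 1] gives the reverse
    bound. *)
Lemma strict_into_id (f : nat -> nat) M :
  (forall t t', t < t' -> t' < M -> f t < f t') ->
  (forall t, t < M -> f t < M) -> forall t, t < M -> f t = t.
Proof.
move=> inc into.
have ge t : t < M -> t <= f t.
  by elim: t => // t IH tM; have := inc t t.+1; lia.
have le d : d < M -> f (M.-1 - d) <= M.-1 - d.
  elim: d => [|d IH] dM; first by have := into (M.-1 - 0); lia.
  by have := inc (M.-1 - d.+1) (M.-1 - d); lia.
move=> t tM; apply/eqP; rewrite eqn_leq ge // andbT.
by have := le (M.-1 - t); rewrite subKn; lia.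
Qed.

Section Classification.
Variables n m k k' a b : nat.
Hypotheses (m_gt1 : 1 < m) (m_lt_n : m < n) (co : coprime m n).
Hypotheses (ab : 1 < a < b) (bn : b <= n).
Hypotheses (ea : orbitn n m a = k') (eb : orbitn n m b = k) (hkk : k < k' < m).
Hypothesis late : forall j, 0 < j <= n -> k < orbitn n m j < m -> j <= a.
Variables (D : data) (x0 : spt) (lab : nat -> nat -> R).
Local Notation E := (orbitn n m).
Local Notation N := (dN D).
Local Notation pi := (dpi D).
Hypothesis star : star_orbit n m x0.
Hypothesis lab01 : forall r s, r < n -> s < N r -> (0 <= lab r s < 1)%R.
Hypothesis lab_lt : forall r s1 s2, r < n -> s1 < s2 -> s2 < N r -> (lab r s1 < lab r s2)%R.
Hypothesis orbE : forall y, orbit_of n m x0 y <->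
  exists r s, r < n /\ s < N r /\ y = SE r (lab r s).
Hypothesis pi_lab : forall r s, r < n -> s < N r ->
  (pi (r, s)).1 < n /\ (pi (r, s)).2 < N (pi (r, s)).1 /\
  fstar n m (SE r (lab r s)) = SE (pi (r, s)).1 (lab (pi (r, s)).1 (pi (r, s)).2).
Hypothesis classes : forall s, s < N 0 ->
  (dA D s <-> loc_rev n m (fun r => lab r 0) (lab 0 s)) /\
  (dB D s <-> loc_pres n m (fun r => lab r 0) (lab 0 s)) /\
  (dC D s <-> loc_noninj n m (fun r => lab r 0) (lab 0 s)).
Hypotheses (pi00 : (pi (0, 0)).1 = k) (B0 : dB D 0).
Hypothesis TTa : forall s, s.+1 < N 0 ->
  (dB D s -> in_alpha n m D (pi (0, s))) /\ (dA D s -> in_beta n m D (pi (0, s))).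
Hypothesis TTb : forall r, k < r < m -> N (r + n - m) = 1.
Hypothesis TTc : forall s, 0 < s -> s < N (k + n - m) ->
  (pi (0, 0)).2 < (pi (k + n - m, s)).2 -> in_beta n m D (pi (k + n - m, s)).

(** * Cyclicity and the base points of an orbit in TT *)

Let n_gt0 : 0 < n. Proof. lia. Qed.
Let L := label n D.
Let pt (y : nat * nat) := SE y.1 (lab y.1 y.2).
Let LE r s : L (r, s) = (r < n) && (s < N r). Proof. by []. Qed.

Let closed y : L y -> L (pi y).
Proof. by case: y => r s /andP[h1 h2]; have [h3 [h4 _]] := pi_lab h1 h2; apply/andP. Qed.

Let iter_pt c y : L y -> iter c (fstar n m) (pt y) = pt (iter c pi y) /\ L (iter c pi y).
Proof.
move=> Ly; elim: c => [//|c [IH Lc]]; rewrite !iterS IH; split; last exact: closed.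
case: (iter c pi y) Lc => r s /andP[h1 h2].
by have [_ [_ ->]] := pi_lab h1 h2.
Qed.

Let pt_inj y z : L y -> L z -> pt y = pt z -> y = z.
Proof.
case: y z => [r s] [r' s'] /andP[/= h1 h2] /andP[/= h3 h4] [e1 e2].
rewrite -{}e1 in h3 h4 e2 *; congr (_, _).
by case: (ltngtP s s') => // h; [have := lab_lt h1 h h4 | have := lab_lt h1 h h2]; lra.
Qed.

Let reach y z : L y -> L z -> exists c, iter c pi y = z.
Proof.
move=> Ly Lz; have [[_ [P [P0 eP]]] _] := star.
have orb_pt u : L u -> orbit_of n m x0 (pt u).
  by case: u => r s /andP[h1 h2]; apply/orbE; exists r, s.
have [j ey] := orb_pt y Ly; have [j' ez] := orb_pt z Lz.
(* From [y], at time [j], another [j * (P - 1)] steps complete [j] periods and return to [x0]; [j']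
   more lead to [z]. *)
exists (j' + j * P.-1); have [e1 Lc] := iter_pt (j' + j * P.-1) Ly.
apply: pt_inj => //; rewrite -e1 ey ez -iterD -addnA addnC -mulnSr prednK //.
rewrite addnC iterD; congr iter.
by elim: (j) => // d IH; rewrite mulSn iterD IH.
Qed.

Let onto z : L z -> exists2 y, L y & pi y = z.
Proof.
move=> Lz; have [c ec] := reach (closed Lz) Lz.
by exists (iter c pi z); [have [] := iter_pt c Lz | rewrite -iterS iterSr].
Qed.

Let N_gt0 r : r < n -> 0 < N r.
Proof.
move=> hr; have [_ [_ [H _]]] := star; have [t /orbE [r' [s [_ [h [-> _]]]]]] := H r hr.
by lia.
Qed.

Let L0 r : r < n -> L (r, 0).
Proof. by move=> hr; rewrite LE hr N_gt0. Qed.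

Let lab_le r s : r < n -> s < N r -> (lab r 0 <= lab r s)%R.
Proof.
move=> hr hs; case: (posnP s) => [->|s0]; first by lra.
by have := lab_lt hr s0 hs; lra.
Qed.

Let pi_off0 r s : L (r, s) -> r != 0 ->
  [/\ L (pi (r, s)), (pi (r, s)).1 = (r + m) %% n
    & lab (pi (r, s)).1 (pi (r, s)).2 = lab r s].
Proof.
move=> Ly r0; have := closed Ly; have /andP[h1 h2] := Ly.
have [_ [_]] := pi_lab h1 h2; rewrite /fstar (negPf r0) => -[<- <-].
by split.
Qed.

Let near0 r : r < n -> nearest n m x0 r (lab r 0).
Proof.
move=> hr; split; first by apply/orbE; exists r, 0; rewrite N_gt0.
by move=> t' /orbE [r' [s [_ [h [er ->]]]]]; rewrite -er in h *; apply: lab_le.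
Qed.

Let pi_base r : 0 < r < n -> pi (r, 0) = ((r + m) %% n, 0).
Proof.
move=> hr; have [_ [_ [_ [_ H]]]] := star.
have rn : r < n by lia.
have rn' : (r + m) %% n < n by rewrite ltn_mod.
have e := H r _ _ hr (near0 rn) (near0 rn').
have [h1 [h2 h3]] := pi_lab rn (N_gt0 rn).
apply: pt_inj; [exact/closed/L0 | exact: L0 |].
by rewrite /pt -h3 e.
Qed.

Let E_neq0 j : 0 < j < n -> E j != 0.
Proof. by move=> hj; apply/eqP => /(orbitn_eq0 n_gt0 co); lia. Qed.

Let E_lt j : E j < n. Proof. exact: ltn_orbitn. Qed.

Let E_inj j l : 0 < j <= n -> 0 < l <= n -> E j = E l -> j = l.
Proof. exact: orbitn_inj. Qed.

Let pi_base_E j : 0 < j < n -> pi (E j, 0) = (E j.+1, 0).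
Proof. by move=> hj; rewrite pi_base ?orbitnS // lt0n E_neq0 // E_lt. Qed.

Let l := lab 0 0.

(** The base points follow one another from [e_m] to [e_0] along edges on which [f] is isometric. *)
Let lab_base r : r < n -> lab r 0 = l.
Proof.
move=> /(orbitn_surj n_gt0 co) [j hj <-].
have step c : 0 < c < n -> lab (E c.+1) 0 = lab (E c) 0.
  by move=> hc; have [_ _] := pi_off0 (L0 (E_lt c)) (E_neq0 hc); rewrite pi_base_E.
suff H c : 0 < c <= n -> lab (E c) 0 = lab (E 1) 0.
  by rewrite H // -(H n) ?orbitn_n //; lia.
by elim: c => [//|[|c] IH] hc //; rewrite step ?IH //; lia.
Qed.

(** The leaf of [e_0] is fixed by [f], so an orbit containing it could not reach [e_m]. *)
Let l_gt0 : (0 < l)%R.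
Proof.
have [h0 _] := lab01 n_gt0 (N_gt0 n_gt0); rewrite -/l in h0.
suff : l <> 0%R by lra.
move=> l0; have [h1 [h2 h3]] := pi_lab n_gt0 (N_gt0 n_gt0).
have e : pi (0, 0) = (0, 0).
  apply: pt_inj; [exact/closed/L0 | exact: L0 |].
  by rewrite /pt -h3 -/l l0 /fstar eqxx fe0_0.
have [c] := reach (L0 n_gt0) (L0 m_lt_n).
have -> : iter c pi (0, 0) = (0, 0) by elim: c => // c IH; rewrite iterS IH.
by case=> m0; move: m_gt1; rewrite -m0.
Qed.

Let l_le r s : L (r, s) -> (l <= lab r s < 1)%R.
Proof.
by move=> /andP[/= h1 h2]; have := lab01 h1 h2; have := lab_le h1 h2; rewrite lab_base //; lra.
Qed.

Let it_base j : j < n -> iter j pi (m, 0) = (orbitn n m j.+1, 0).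
Proof.
by elim: j => [|j IH] hj; [rewrite orbitn1 | rewrite iterS IH ?pi_base_E //; lia].
Qed.

Let L_m0 : L (m, 0) := L0 m_lt_n.
Let L_reach y (Ly : L y) := reach L_m0 Ly.
Let L_back := onto L_m0.
Let pi_inj y z : L y -> L z -> pi y = pi z -> y = z :=
  dpi_inj closed L_m0 L_reach L_back (y := y) (z := z).

(** * Images of the points of [e_0] *)

Let g s := (pi (0, s)).1.
Let v s := (pi (0, s)).2.
Let pi0E s : pi (0, s) = (g s, v s). Proof. exact: surjective_pairing. Qed.
Let y s := lab (g s) (v s).

Let Lgv s : s < N 0 -> L (g s, v s).
Proof. by move=> hs; rewrite -pi0E; apply: closed; rewrite LE n_gt0. Qed.

Let fe0_pi s : s < N 0 -> g s <= m /\ exists2 rev : bool, rev -> 0 < g s &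
  ((2 * INR m + 1) * lab 0 s = 2 * INR (g s) + sg rev * y s)%R.
Proof.
move=> hs; have [h1 [h2 h3]] := pi_lab n_gt0 hs.
have Ly := l_le (Lgv hs); have := l_gt0 => l0.
have [|||h4 h5 h6] := @fe0_inv m (lab 0 s) (g s) (y s); rewrite /y; try lra.
- exact: lab01.
- by rewrite -h3.
- by split.
Qed.

(** A base label other than [(m,0)] already is the image of the preceding base point, which is off
    [e_0]; injectivity excludes a second preimage. *)
Let base_image s : s < N 0 -> v s = 0 -> g s = m.
Proof.
move=> hs vs; have := Lgv hs; rewrite LE vs => /andP[gn _].
have [[|[|j]] // hj ej] := orbitn_surj n_gt0 co gn; first by rewrite -ej orbitn1.
have : (E j.+1, 0) = (0, s).
  apply: pi_inj; [exact: L0 | by rewrite LE n_gt0 |].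
  by rewrite pi_base_E ?pi0E ?vs ?ej //; lia.
by case=> e _; have := @E_neq0 j.+1 ltac:(lia); rewrite e.
Qed.

Let class_gt s (rev : bool) : s < N 0 -> pi (0, s) <> (m, 0) -> (rev -> 0 < g s) ->
  ((2 * INR m + 1) * lab 0 s = 2 * INR (g s) + sg rev * y s)%R ->
  [/\ dA D s = rev, dB D s = ~~ rev & dC D s = false].
Proof.
move=> hs ne hr es; have vs : v s <> 0 by move=> vs; apply: ne; rewrite pi0E vs base_image.
have Lz := Lgv hs; have /andP[/= h1 h2] := Lz.
have ly : (l < y s)%R.
  rewrite -(lab_base h1) /y; apply: lab_lt => //; lia.
have l0 := l_gt0; have hl := l_le (_ : L (0, s)); have hy := l_le Lz.
have [c1 c2 c3] := loc_type_gt n (lo := fun r => lab r 0) (lab_base h1) (lab_base n_gt0)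
  (hl ltac:(by rewrite LE n_gt0)) l0 (y := y s) (conj (Rlt_trans _ _ _ l0 ly) (proj2 hy)) hr es ly.
have [iA [iB iC]] := classes hs.
split; [apply/idP/idP; tauto | apply/idP/idP; tauto |].
by apply/negP => /iC.
Qed.

Let class_eq s : s < N 0 -> 0 < s -> pi (0, s) = (m, 0) ->
  [/\ dA D s = false, dB D s = false & dC D s = true].
Proof.
move=> hs s0 e; have [gm [rev hr es]] := fe0_pi hs.
have [eg ev] : g s = m /\ v s = 0 by move: e; rewrite pi0E => -[].
have ly : l = y s by rewrite /y ev eg lab_base.
have h1 : g s < n by rewrite eg.
have lt : (l < lab 0 s)%R by apply: lab_lt.
have l0 := l_gt0; have hl := l_le (_ : L (0, s)); have hy := l_le (Lgv hs).
have [c1 c2 c3] := loc_type_eq n (lo := fun r => lab r 0) (lab_base h1) (lab_base n_gt0)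
  (hl ltac:(by rewrite LE n_gt0)) l0 (y := y s) ltac:(rewrite -/(y s) in hy; lra) hr es ly lt.
have [iA [iB iC]] := classes hs.
by split; [apply/negP | apply/negP | apply/idP]; tauto.
Qed.

Let eqn s (rev : bool) :=
  ((2 * INR m + 1) * lab 0 s = 2 * INR (g s) + sg rev * y s)%R.

(** The pieces of [e_0] lie over edges of nondecreasing index; over the same edge the backward piece
    precedes the forward one, and the latter preserves order. *)
Let e0_cmp s s' (rev rev' : bool) : s < s' -> s' < N 0 -> eqn s rev -> eqn s' rev' ->
  g s <= g s' /\ (g s = g s' -> (rev' -> rev) /\ (~~ rev -> v s < v s')).
Proof.
move=> ss' hs'; have hs : s < N 0 by lia.
have := lab_lt n_gt0 ss' hs'; have := l_gt0; have m0 := pos_INR m.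
have := l_le (Lgv hs); have := l_le (Lgv hs'); rewrite -!/(y _) => y1 y2 l0 lt.
have {}lt : ((2 * INR m + 1) * lab 0 s < (2 * INR m + 1) * lab 0 s')%R.
  by apply: Rmult_lt_compat_l; lra.
rewrite /eqn => e1 e2; rewrite e1 e2 in lt; split.
  rewrite leqNgt; apply/negP => /INR_ltn.
  by case: rev {e1} lt; case: rev' {e2}; rewrite /sg; lra.
move=> eg; rewrite eg in lt; split.
  by case: rev {e1} lt; case: rev' {e2}; rewrite /sg //; lra.
case: rev {e1} lt => // lt _; rewrite ltnNge; apply/negP => vv.
have : (y s' <= y s)%R; last by case: rev' {e2} lt; rewrite /sg; lra.
have /andP[/= h1 h2] := Lgv hs.
rewrite /y -eg; case: (ltngtP (v s') (v s)) vv => // [h _|-> _]; last by lra.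
by have := lab_lt h1 h h2; lra.
Qed.

Let N00 : 0 < N 0 := N_gt0 n_gt0.

Let eqn0 : eqn 0 false.
Proof.
have [_ [rev hr es]] := fe0_pi N00.
have [|_ eB _] := class_gt N00 _ hr es.
  by rewrite pi0E => -[e _]; move: pi00 hkk; rewrite -/(g 0) e; lia.
by move: eB es; rewrite B0 => /esym/negPf ->.
Qed.

Let g_ge s : s < N 0 -> k <= g s.
Proof.
move=> hs; have [_ [rev _ es]] := fe0_pi hs.
case: (posnP s) => [->|s0]; first by rewrite /g pi00.
by have [] := e0_cmp s0 hs eqn0 es; rewrite {1}/g pi00.
Qed.

Let eqn_uniq s (rev rev' : bool) : s < N 0 -> eqn s rev -> eqn s rev' -> rev = rev'.
Proof.
move=> hs; have := l_le (Lgv hs); have := l_gt0; rewrite -/(y s) /eqn => l0 hy -> .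
by case: rev; case: rev'; rewrite /sg //; lra.
Qed.

(** The point 0, being in B, already lies on the forward piece over [e_k], which follows the
    backward one. *)
Let rev_k s (rev : bool) : s < N 0 -> g s = k -> eqn s rev -> rev = false.
Proof.
move=> hs gk es; case: (posnP s) => [s0|s0].
  by apply: eqn_uniq es _ => //; rewrite s0; exact: eqn0.
have [_ H] := e0_cmp s0 hs eqn0 es; have [|h _] := H; first by rewrite gk /g pi00.
by apply/negP => /h.
Qed.

Let pi_lt r s s' : r != 0 -> L (r, s') -> s < s' -> (pi (r, s)).2 < (pi (r, s')).2.
Proof.
move=> r0 Ly' ss'; have /andP[/= h1 h2] := Ly'.
have Ly : L (r, s) by rewrite LE h1; lia.
have [z1 e1 l1] := pi_off0 Ly r0; have [z2 e2 l2] := pi_off0 Ly' r0.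
have := lab_lt h1 ss' h2; rewrite -l1 -l2 e1 e2 => lt.
rewrite ltnNge leq_eqVlt; apply/negP => /orP[/eqP e|h]; first by rewrite e in lt; lra.
move: z1; case ez: (pi (r, s)) => [u w]; rewrite ez in e1 h lt; rewrite /= in e1 h lt.
by rewrite LE => /andP[g1 g2]; rewrite e1 in g1 g2; have := lab_lt g1 h g2; lra.
Qed.

Let pi_E j s : 0 < j < n -> s < N (E j) ->
  pi (E j, s) = (E j.+1, (pi (E j, s)).2) /\ (pi (E j, s)).2 < N (E j.+1).
Proof.
move=> hj hs; have Ly : L (E j, s) by rewrite LE E_lt.
have [Lz e _] := pi_off0 Ly (E_neq0 hj); move: Lz e.
by case: (pi _) => r s' /= + e; rewrite LE e orbitnS => /andP[].
Qed.

(** Off [e_0], each edge embeds in order into the next edge of the time order. *)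
Let N_le j c : 0 < j <= c -> c <= n -> N (E j) <= N (E c).
Proof.
move=> /andP[j0]; elim: c => [|c IH]; first by lia.
rewrite leq_eqVlt => /orP[/eqP -> //|jc] cn.
apply: (leq_trans (IH jc ltac:(lia))).
have hc : 0 < c < n by lia.
have ge s : s < N (E c) -> s <= (pi (E c, s)).2.
  elim: s => // s IHs hs; apply: leq_ltn_trans (IHs (ltnW hs)) _.
  by apply: pi_lt (E_neq0 hc) _ (leqnn _); rewrite LE E_lt.
have h0 := N_gt0 (E_lt c).
have lt : (N (E c)).-1 < N (E c) by lia.
by have [_ h] := pi_E hc lt; have := leq_ltn_trans (ge _ lt) h; lia.
Qed.

Let N_R j : 0 < j < a -> N (E j) = 1.
Proof.
move=> hj; have e : N (E a.-1) = 1.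
  by rewrite -orbitn_pred ?ea //; [exact: TTb | lia | lia].
by have := @N_le j a.-1 ltac:(lia) ltac:(lia); have := N_gt0 (E_lt j); lia.
Qed.

(** An edge strictly between [k] and [m] has time at most [a]. Before time [a] edges carry only
    their base point, and among base points [e_0] hits only [(m,0)]. *)
Let g_cases s : s < N 0 -> [\/ g s = k, g s = k' | pi (0, s) = (m, 0)].
Proof.
move=> hs; have [gm _] := fe0_pi hs; have gk := g_ge hs.
have [c hc ec] := @orbitn_surj n m n_gt0 co (g s) ltac:(lia).
have [g1|g1] := eqVneq (g s) k; first by constructor 1.
have vE j : 0 < j < a -> c = j -> v s = 0.
  by move=> hj cj; have := Lgv hs; rewrite LE -ec cj N_R // => /andP[_]; case: (v s).
have [g2|g2] := eqVneq (g s) m.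
  constructor 3; rewrite pi0E g2 (vE 1) //; first by lia.
  by apply: E_inj; rewrite ?orbitn1 ?ec //; lia.
have ca : c <= a by apply: late; rewrite ?ec; lia.
have [c1|c1] := eqVneq c a; first by constructor 2; rewrite -ec c1.
have v0 : v s = 0 by apply: (vE c) => //; lia.
by move: g2; rewrite base_image ?eqxx.
Qed.

(** * The indices [q] and [p], and the passages between edges *)

Let q := (N 0).-1.

(** Only [e_0] and [e_{k}] for [k = 0] precede [e_m], so the preimage of [(m,0)] is in [e_0]. As [g]
    is nondecreasing, the top point also lands on [e_m], which carries only its base point. *)
Let pi_q : pi (0, q) = (m, 0).
Proof.
have [[r s] Ly e] := onto L_m0.
have r0 : r = 0.
  apply/eqP; case: (eqVneq r 0) => // r0.
  have [_] := pi_off0 Ly r0; rewrite e /= => em _.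
  move: Ly; rewrite LE => /andP[rn _]; move: em.
  by case: (ltnP (r + m) n) => h; [rewrite modn_small; lia |];
     rewrite -(subnK h) modnDr modn_small; lia.
rewrite r0 in Ly e; have hs : s < N 0 by move: Ly; rewrite LE => /andP[].
have [<-//|sq] : s = q \/ s < q by rewrite /q; lia.
have hq : q < N 0 by rewrite /q; lia.
have [_ [rev _ es]] := fe0_pi hs; have [_ [rev' _ eq]] := fe0_pi hq.
have [] := e0_cmp sq hq es eq; rewrite {1}/g e /= => gm _.
case: (g_cases hq) => // gq; move: gm; rewrite gq; lia.
Qed.

Let q_gt0 : 0 < q.
Proof.
by rewrite lt0n; apply/eqP => q0; have := pi_q; rewrite q0 => e; move: pi00 hkk; rewrite e /=; lia.
Qed.

Let hN0 : N 0 = q.+1. Proof. by rewrite /q prednK. Qed.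

Let pi_q_uniq s : s <= q -> pi (0, s) = (m, 0) -> s = q.
Proof.
move=> hs e; have : (0, s) = (0, q); last by case.
by apply: pi_inj; rewrite ?LE ?n_gt0 ?hN0 ?ltnS ?leqnn // pi_q.
Qed.

Let p_ex : exists s, (s <= q) && (g s != k).
Proof. by exists q; rewrite leqnn /g pi_q /=; apply/eqP; lia. Qed.

Let p := ex_minn p_ex.

Let p_le : p <= q. Proof. by rewrite /p; case: ex_minnP => s /andP[]. Qed.

Let g_lt_p s : s < p -> g s = k.
Proof.
rewrite /p; case: ex_minnP => r /andP[rq _] min sr; apply/eqP/negPn/negP => h.
by have := min s; rewrite h andbT; lia.
Qed.

Let g_ge_p s : p <= s < q -> g s = k'.
Proof.
move=> hs; have sq : s <= q by lia.
have hN : s < N 0 by lia.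
case: (g_cases hN) => // [gk|/(pi_q_uniq sq)]; last by lia.
have gp : g p != k by rewrite /p; case: ex_minnP => r /andP[].
have [ps|ps] : p = s \/ p < s by lia.
  by move: gp; rewrite ps gk eqxx.
have hp : p < N 0 by lia.
have [_ [rev _ e1]] := fe0_pi hp; have [_ [rev' _ e2]] := fe0_pi hN.
have [h _] := e0_cmp ps hN e1 e2; have := g_ge hp; move: gp h; rewrite gk => /eqP; lia.
Qed.

Let p_gt0 : 0 < p.
Proof.
rewrite /p; case: ex_minnP => r /andP[_ h] _; rewrite lt0n; apply/eqP => r0.
by move: h; rewrite r0 /g pi00 eqxx.
Qed.

(* No point of e_0 lands on the edge e_{E j.+1}, so the passage from e_{E j} to it
   is a bijection. *)
Let pi_generic j : 0 < j < n -> j.+1 != a -> j.+1 != b ->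
  N (E j) = N (E j.+1) /\ forall s, s < N (E j) -> pi (E j, s) = (E j.+1, s).
Proof.
move=> hj ja jb.
have [|||eN eid] := @strict_onto_id (fun s => (pi (E j, s)).2) (N (E j)) (N (E j.+1)).
- by move=> t t' tt' ht; apply: pi_lt => //; [exact: E_neq0 | rewrite LE E_lt].
- by move=> t ht; have [] := pi_E hj ht.
- move=> s hs; have [[r u] Ly e] : exists2 z, L z & pi z = (E j.+1, s).
    by apply: onto; rewrite LE E_lt.
  move: Ly; rewrite LE => /andP[rn ru].
  have [r0|r0] := eqVneq r 0.
    rewrite r0 in ru e; exfalso.
    have eg : g u = E j.+1 by rewrite /g e.
    case: (g_cases ru) => h.
    + by move/eqP: jb; apply; apply: E_inj; rewrite -?eg ?h ?eb //; lia.
    + by move/eqP: ja; apply; apply: E_inj; rewrite -?eg ?h ?ea //; lia.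
    + have := @E_inj j.+1 1; rewrite -eg orbitn1 // /g h /= => /(_ _ _ erefl); lia.
  have [_] := @pi_off0 r u ltac:(by rewrite LE rn) r0; rewrite e /= => em _.
  have [c hc ec] := orbitn_surj n_gt0 co rn.
  have cn : c <> n by move=> cn; move: r0; rewrite -ec cn orbitn_n.
  have cj : c.+1 = j.+1 by apply: E_inj; rewrite ?em ?orbitnS ?ec //; lia.
  by exists u; [rewrite -(succn_inj cj) ec | rewrite -(succn_inj cj) ec e].
split=> // s hs; have [-> _] := pi_E hj hs.
by rewrite eid.
Qed.

Let N_T j : b <= j <= n -> N (E j) = q.+1.
Proof.
move=> hj; suff H d : d <= n - b -> N (E (n - d)) = q.+1.
  by rewrite -(subKn (_ : j <= n)) ?H; lia.
elim: d => [|d IH] hd; first by rewrite subn0 orbitn_n.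
have e : (n - d.+1).+1 = n - d by lia.
by have [-> _] := @pi_generic (n - d.+1) ltac:(lia) ltac:(lia) ltac:(lia); rewrite e IH; lia.
Qed.

Let N_S j : a <= j < b -> N (E j) = N (E a).
Proof.
elim: j => [|j IH] hj; first by lia.
have [->//|aj] : j.+1 = a \/ a <= j by lia.
by have [<- _] := @pi_generic j ltac:(lia) ltac:(lia) ltac:(lia); rewrite IH; lia.
Qed.

Let w := (N (E a)).-1.
Let hNa : N (E a) = w.+1. Proof. by rewrite /w prednK // N_gt0. Qed.

Let k_lt : k < n. Proof. lia. Qed.
Let Lk s : L (k, s) = (s <= q).
Proof. by rewrite LE k_lt -eb N_T //; lia. Qed.

(** * Colours and the turning point *)

Let beta := in_beta n m D.
Let beta_step j s : 0 < j < n -> s < N (E j) -> s != 0 -> (pi (E j, s)).2 != 0 ->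
  beta (E j, s) <-> beta (pi (E j, s)).
Proof.
move=> hj hs s0 s1; have Ly : L (E j, s) by rewrite LE E_lt.
have := in_beta_step closed L_m0 L_reach L_back it_base n_gt0 co Ly s0 s1.
by rewrite /flip /= (negPf (E_neq0 hj)).
Qed.

Let beta_k s : 0 < s <= q -> beta (k, s) <-> beta (0, s).
Proof.
move=> hs; suff H d : d <= n - b -> beta (E (n - d), s) <-> beta (0, s).
  by rewrite -eb -(subKn (_ : b <= n)) //; apply: H.
elim: d => [|d IH] hd; first by rewrite subn0 orbitn_n.
have e : (n - d.+1).+1 = n - d by lia.
have [_ ep] := @pi_generic (n - d.+1) ltac:(lia) ltac:(lia) ltac:(lia).
have hN : s < N (E (n - d.+1)) by rewrite N_T; lia.
have := @beta_step (n - d.+1) s ltac:(lia) hN; rewrite ep // e /= => H.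
by have := H ltac:(lia) ltac:(lia); have := IH ltac:(lia); tauto.
Qed.

(** The passage from the last edge of S into [e_k]: the one passage off [e_0] that need not preserve
    labels. *)
Let chi s := (pi (E b.-1, s)).2.

Let b1 : 0 < b.-1 < n. Proof. lia. Qed.
Let hNb1 : N (E b.-1) = w.+1. Proof. by rewrite N_S ?hNa //; lia. Qed.

Let pi_chi s : s <= w -> pi (E b.-1, s) = (k, chi s) /\ chi s <= q.
Proof.
move=> hs; have [] := @pi_E b.-1 s b1; first by rewrite hNb1.
by rewrite prednK ?eb; [move=> -> ; rewrite -eb N_T //; lia | lia].
Qed.

Let chi_lt s s' : s < s' -> s' <= w -> chi s < chi s'.
Proof. by move=> ss' h; apply: pi_lt; rewrite ?E_neq0 // LE E_lt hNb1. Qed.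

Let chi0 : chi 0 = 0.
Proof. by rewrite /chi pi_base_E. Qed.

Let chi_gt0 s : 0 < s <= w -> 0 < chi s.
Proof. by move=> /andP[s0 sw]; rewrite -{1}chi0; apply: chi_lt. Qed.

Let beta_k' s : 0 < s <= w -> beta (k', s) <-> beta (0, chi s).
Proof.
move=> hs; have sw : s <= w by lia.
have [e1 e2] := pi_chi sw; have c0 := chi_gt0 hs.
have H1 : beta (E b.-1, s) <-> beta (0, chi s).
  have hN : s < N (E b.-1) by rewrite hNb1.
  have := beta_step b1 hN; rewrite e1 /= => H.
  have := beta_k (_ : 0 < chi s <= q); rewrite c0 e2 => /(_ isT).
  by have := H ltac:(lia) ltac:(lia); tauto.
suff H d : d <= b.-1 - a -> beta (E (b.-1 - d), s) <-> beta (E b.-1, s).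
  have := H (b.-1 - a) (leqnn _); rewrite subKn ?ea; last lia.
  by tauto.
elim: d => [|d IH] hd; first by rewrite subn0.
have e : (b.-1 - d.+1).+1 = b.-1 - d by lia.
have [_ ep] := @pi_generic (b.-1 - d.+1) ltac:(lia) ltac:(lia) ltac:(lia).
have hN : s < N (E (b.-1 - d.+1)) by rewrite N_S ?hNa; lia.
have := @beta_step (b.-1 - d.+1) s ltac:(lia) hN; rewrite ep // e /= => H'.
by have := H' ltac:(lia) ltac:(lia); have := IH ltac:(lia); tauto.
Qed.

Let beta_q : beta (0, q).
Proof.
apply: (in_beta_back closed L_m0 L_reach L_back it_base n_gt0 co).
- by rewrite -/L LE n_gt0 hN0 /=.
- by rewrite /= -lt0n.
- exact: pi_q.
Qed.

(* For 0 < s < q, [s in A] forces pi(0,s) in beta and [s in B] forces it in alpha;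
   in both cases (0,s) itself lies in alpha. *)
Let not_beta s : 0 < s < q -> ~ beta (0, s).
Proof.
move=> hs; have sN : s < N 0 by lia.
have Ly : L (0, s) by rewrite LE n_gt0.
have ne : pi (0, s) <> (m, 0) by move=> /pi_q_uniq; lia.
have v0 : (pi (0, s)).2 != 0.
  by apply/eqP => v0; apply: ne; rewrite pi0E base_image // [v s]v0.
have [_ [rev hr es]] := fe0_pi sN; have [eA eB _] := class_gt sN ne hr es.
have := in_beta_step closed L_m0 L_reach L_back it_base n_gt0 co Ly ltac:(rewrite /=; lia) v0.
have := in_beta_not_alpha closed L_m0 L_reach L_back it_base n_gt0 co (closed Ly) v0.
have hs1 : s.+1 < N 0 by lia.
have [] := TTa hs1.
rewrite /flip /= eA eB -/beta.
by case: rev {es hr eA eB} => /= [_ /(_ isT)|/(_ isT) + _]; tauto.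
Qed.

Let v_gt0 s : s < q -> 0 < v s.
Proof.
move=> sq; rewrite lt0n; apply/eqP => v0.
have hs : s < N 0 by lia.
have : s = q by apply: pi_q_uniq; [exact: ltnW | rewrite pi0E base_image // v0].
by lia.
Qed.

(** Condition (a) read in both directions: types A and B are exclusive, and so are the two
    colours. *)
Let rev_beta s : s < q -> exists rev : bool, [/\ eqn s rev, dA D s = rev, dB D s = ~~ rev,
  dC D s = false & beta (pi (0, s)) <-> rev].
Proof.
move=> sq; have hs : s < N 0 by lia.
have ne : pi (0, s) <> (m, 0) by move=> /pi_q_uniq; lia.
have Ly : L (0, s) by rewrite LE n_gt0.
have v0 : (pi (0, s)).2 != 0 by rewrite -lt0n v_gt0.
have [_ [rev hr es]] := fe0_pi hs; have [eA eB eC] := class_gt hs ne hr es.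
exists rev; split=> //.
have := in_beta_not_alpha closed L_m0 L_reach L_back it_base n_gt0 co (closed Ly) v0.
have hs1 : s.+1 < N 0 by lia.
have [] := TTa hs1; rewrite eA eB -/beta.
by case: rev {es hr eA eB} => /= [_ /(_ isT)|/(_ isT) + _]; split=> //; tauto.
Qed.

(* The point entering the top of e_k turns around at the critical value k', and is the
   only one to do so. *)
Let turning : exists s1, [/\ p <= s1 < q, eqn s1 true, v s1 = w, 0 < w & chi w = q].
Proof.
have [[r t] Ly e] : exists2 z, L z & pi z = (k, q) by apply: onto; rewrite Lk.
have bkq : beta (k, q) by apply/beta_k; [rewrite q_gt0 leqnn | exact: beta_q].
move: Ly; rewrite LE => /andP[rn rt].
(* A preimage in [e_0] of the beta label [(k,q)] would be reversing by (a), but every point of [e_0]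
   over [e_k] is on the forward branch. *)
have [r0|r0] := eqVneq r 0.
  rewrite r0 in rt e.
  have gk : g t = k by rewrite /g e.
  have tq : t < q.
    have [tq|//] : t = q \/ t < q by lia.
    by move: gk; rewrite tq /g pi_q /=; lia.
  have [rev [es _ _ _ bt]] := rev_beta tq; have hr := rev_k rt gk es.
  by move: bt; rewrite e hr => -[/(_ bkq)].
have [_] := @pi_off0 r t ltac:(by rewrite LE rn) r0; rewrite e /= => em _.
have rb : r = E b.-1.
  have [c hc ec] := orbitn_surj n_gt0 co rn.
  have cn : c <> n by move=> cn; move: r0; rewrite -ec cn orbitn_n.
  have cj : c.+1 = b by apply: E_inj; rewrite ?eb ?em ?orbitnS ?ec //; lia.
  by rewrite -ec -cj.
rewrite rb hNb1 in rt e; have ct : chi t = q by rewrite /chi e.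
have tw : t = w.
  have [//|tw] : t = w \/ t < w by lia.
  by have := chi_lt tw (leqnn w); have [_] := pi_chi (leqnn w); rewrite ct; lia.
have w0 : 0 < w.
  by rewrite lt0n -tw; apply/eqP => t0; move: ct; rewrite t0 chi0; lia.
rewrite tw in ct.
(* The label [(k',w)] is carried to [(0,q)], hence beta. The preceding edge in R offers only its
   base point, so the preimage is in [e_0] and reversing by (a). *)
have [[r' s1] Ly' e'] : exists2 z, L z & pi z = (k', w).
  by apply: onto; rewrite LE -ea hNa E_lt /=.
have bw : beta (k', w) by apply/beta_k'; rewrite ?w0 ?leqnn // ct; exact: beta_q.
move: Ly'; rewrite LE => /andP[rn' rt'].
have r0' : r' = 0.
  apply/eqP; case: (eqVneq r' 0) => // r0'.
  have [_] := @pi_off0 r' s1 ltac:(by rewrite LE rn') r0'; rewrite e' /= => em' _.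
  have [c hc ec] := orbitn_surj n_gt0 co rn'.
  have cn : c <> n by move=> cn; move: r0'; rewrite -ec cn orbitn_n.
  have cj : c.+1 = a by apply: E_inj; rewrite ?ea ?em' ?orbitnS ?ec //; lia.
  have s10 : s1 = 0 by move: rt'; rewrite -ec N_R; lia.
  move: e'; rewrite s10 -ec pi_base_E; last by lia.
  by case=> _ w0'; move: w0; rewrite -w0'.
rewrite r0' in rt' e'.
have [sq|sq] : s1 = q \/ s1 < q by lia.
  by move: e'; rewrite sq pi_q => -[]; lia.
have ps : p <= s1.
  rewrite leqNgt; apply/negP => /g_lt_p; rewrite /g e' /=; lia.
have [rev [es _ _ _ bt]] := rev_beta sq.
exists s1; split=> //; first by rewrite ps sq.
- by move: bt es; rewrite e'; case: rev => // H; have /H := bw.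
- by rewrite /v e'.
Qed.

(** A reversing point has a beta image, which is carried to [chi (v s)] in [e_0]. There only
    [q = chi w] can be beta, and [chi] is injective. *)
Let turn_uniq s : p <= s < q -> eqn s true -> v s = w.
Proof.
move=> hs es; have sq : s < q by lia.
have hN : s < N 0 by lia.
have [rev [es' _ _ _ bt]] := rev_beta sq.
have gk := g_ge_p hs.
have vw : v s <= w by have := Lgv hN; rewrite LE gk -ea hNa => /andP[].
have v0 := v_gt0 sq.
have : beta (pi (0, s)) by apply/bt; rewrite (eqn_uniq hN es' es).
rewrite pi0E gk => /beta_k'; rewrite v0 vw => /(_ isT).
have [_ cq] := pi_chi vw; have c0 := chi_gt0 (introT andP (conj v0 vw)) => bc.
have cvq : chi (v s) = q.
  by apply/eqP; rewrite eqn_leq cq leqNgt; apply/negP => lt; apply: not_beta bc; lia.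
have [//|lt] : v s = w \/ v s < w by lia.
by have := chi_lt lt (leqnn w); have [_] := pi_chi (leqnn w); rewrite cvq; lia.
Qed.

Let v_inj s s' : s < N 0 -> s' < N 0 -> g s = g s' -> v s = v s' -> s = s'.
Proof.
move=> h h' eg ev; have : (0, s) = (0, s'); last by case.
by apply: pi_inj; rewrite ?LE ?n_gt0 // !pi0E eg ev.
Qed.

(** If the turning point were above [p], then [p], lower over the same edge, would be reversing as
    well and would share its image. *)
Let turn_p : [/\ p < q, eqn p true, v p = w, 0 < w & chi w = q].
Proof.
have [s1 [hs es vs w0 cw]] := turning.
have [ps|ps] : p = s1 \/ p < s1 by lia.
  by rewrite ps; split=> //; lia.
have hp : p < N 0 by lia.
have hs1 : s1 < N 0 by lia.
have gp : g p = g s1 by rewrite !g_ge_p //; lia.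
have [_ [rev _ ep]] := fe0_pi hp.
have [_ /(_ gp) [/(_ isT) hr _]] := e0_cmp ps hs1 ep es.
have vp : v p = w by apply: turn_uniq; [lia | rewrite -hr].
by have := v_inj hp hs1 gp; rewrite vp vs => /(_ erefl); lia.
Qed.

(** * Explicit labels of the images *)

Let p_lt_q : p < q. Proof. by have [] := turn_p. Qed.
Let v_p : v p = w. Proof. by have [] := turn_p. Qed.
Let w_gt0 : 0 < w. Proof. by have [] := turn_p. Qed.
Let chi_w : chi w = q. Proof. by have [] := turn_p. Qed.

Let rev_p s (rev : bool) : s < q -> eqn s rev -> rev = (s == p).
Proof.
move=> sq es; have hs : s < N 0 by lia.
have hp : p < N 0 by lia.
have [_ ep _ _ _] := turn_p.
have [e|e|e] := ltngtP s p.
- exact: rev_k (g_lt_p e) es.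
- case: rev es => // es; have hps : p <= s < q by lia.
  have vs := turn_uniq hps es.
  have gp : g s = g p by rewrite !g_ge_p //; lia.
  by have := v_inj hs hp gp; rewrite vs v_p => /(_ erefl); lia.
- by rewrite e in es; exact: eqn_uniq hp es ep.
Qed.

Let classes_lt s : s < q -> [/\ dA D s = (s == p), dB D s = (s != p) & dC D s = false].
Proof. by move=> sq; have [rev [/(rev_p sq) <- -> -> ->]] := rev_beta sq. Qed.

Let v_lt s s' : s < s' -> s' < q -> s != p -> g s = g s' -> v s < v s'.
Proof.
move=> ss' sq sp eg; have hs' : s' < N 0 by lia.
have hs : s < N 0 by lia.
have [_ [rev _ es]] := fe0_pi hs; have [_ [rev' _ es']] := fe0_pi hs'.
have [_ /(_ eg) [_]] := e0_cmp ss' hs' es es'; apply.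
by rewrite (rev_p _ es) //; lia.
Qed.

Let entry_a : w = q - p /\ forall s, p < s < q -> v s = s - p.
Proof.
(* The labels of [e_k'] from the bottom: the base point, the images of [p+1..q-1], and on top the
   image of [p]. *)
pose f t := if t == 0 then 0 else if t < q - p then v (p + t) else w.
have vw s : p < s < q -> v s < w.
  move=> hs; have hN : s < N 0 by lia.
  have hp : p < N 0 by lia.
  have gs := @g_ge_p s ltac:(lia).
  have := Lgv hN; rewrite LE gs -ea hNa => /andP[_].
  have := @v_inj s p hN hp; rewrite gs g_ge_p ?v_p; last lia.
  by move=> /(_ erefl); lia.
have [|||eM fid] := @strict_onto_id f (q - p).+1 w.+1.
- move=> t t' tt' ht'; rewrite /f; have -> : (t' == 0) = false by lia.
  have -> : t < q - p by lia.
  case: eqP => t0; case: (ltnP t' (q - p)) => h1 //.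
  + by apply: v_gt0; lia.
  + by apply: v_lt; [lia | lia | lia | rewrite !g_ge_p //; lia].
  + by apply: vw; lia.
- move=> t ht; rewrite /f; do !case: ifP => // ?.
  by apply: ltnW; apply: vw; lia.
- move=> s hs; have [s0|s0] := posnP s; first by exists 0; rewrite ?/f //.
  have [[r t] Ly e] : exists2 z, L z & pi z = (k', s).
    by apply: onto; rewrite LE -ea hNa E_lt.
  move: Ly; rewrite LE => /andP[rn rt].
  have r0 : r = 0.
    apply/eqP; case: (eqVneq r 0) => // r0.
    have [_] := @pi_off0 r t ltac:(by rewrite LE rn) r0; rewrite e /= => em _.
    have [c hc ec] := orbitn_surj n_gt0 co rn.
    have cn : c <> n by move=> cn; move: r0; rewrite -ec cn orbitn_n.
    have cj : c.+1 = a by apply: E_inj; rewrite ?ea ?em ?orbitnS ?ec //; lia.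
    have t0 : t = 0 by move: rt; rewrite -ec N_R; lia.
    move: e; rewrite t0 -ec pi_base_E; last by lia.
    by case=> _ w0'; move: s0; rewrite -w0'.
  rewrite r0 in rt e.
  have tq : t <> q by move=> tq; move: e; rewrite tq pi_q => -[]; lia.
  have tp : p <= t.
    by rewrite leqNgt; apply/negP => /g_lt_p; rewrite /g e /=; lia.
  have ev : v t = s by rewrite /v e.
  have [tp'|tp'] : t = p \/ p < t by lia.
    exists (q - p) => //; rewrite /f ltnn; have -> : (q - p == 0) = false by lia.
    by rewrite -ev tp' v_p.
  exists (t - p); first by lia.
  rewrite /f; have -> : (t - p == 0) = false by lia.
  have -> : t - p < q - p by lia.
  by rewrite subnKC.
split; first by case: eM.
move=> s hs; have := fid (s - p); rewrite /f.
have -> : (s - p == 0) = false by lia.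
have -> : s - p < q - p by lia.
by rewrite subnKC => [->|]; lia.
Qed.

Let hw : w = q - p. Proof. by case: entry_a. Qed.

Let entry_b : (forall t, t < q - p -> chi t = t) /\ forall s, s < p -> v s = q - p + s.
Proof.
have kpred : k + n - m = E b.-1 by rewrite -orbitn_pred ?eb //; lia.
(* Above [v 0] condition (c) would force beta, but below [q] nothing in [e_0] is beta. *)
have chi_v0 t : t < q - p -> chi t < v 0.
  move=> ht; have [t0|t0] := posnP t; first by rewrite t0 chi0; exact: v_gt0.
  have tw : t <= w by rewrite hw ltnW.
  have [et ctq] := pi_chi tw.
  have lt : chi t < q by rewrite -chi_w; apply: chi_lt; rewrite ?hw.
  have c0 := chi_gt0 (introT andP (conj t0 tw)).
  have [//|h|h] := ltngtP (chi t) (v 0).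
    have := TTc (s := t); rewrite kpred hNb1 et => /(_ t0 ltac:(lia) h) /beta_k -/(_ ltac:(lia)).
    by case/not_beta; lia.
  have : (E b.-1, t) = (0, 0); last by case=> e _; have := E_neq0 b1; rewrite e.
  apply: pi_inj; [by rewrite LE E_lt hNb1 | exact: L0 |].
  by rewrite et pi0E h /g pi00.
(* The labels of [e_k] from the bottom: the lower points of the preceding edge, the images of
   [0..p-1], and the top point. *)
pose f t := if t < q - p then chi t else if t < q then v (t - (q - p)) else q.
have vq s : s < p -> v s < q.
  move=> sp; have hs : s < N 0 by lia.
  have := Lgv hs; rewrite g_lt_p // Lk leq_eqVlt => /orP[/eqP vq|//].
  have : (E b.-1, w) = (0, s); last by case=> e _; have := E_neq0 b1; rewrite e.
  apply: pi_inj; [by rewrite LE E_lt hNb1 /= | by rewrite LE n_gt0 |].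
  by have [-> _] := pi_chi (leqnn w); rewrite pi0E g_lt_p // vq chi_w.
have v_le s : s < p -> v 0 <= v s.
  move=> sp; case: (posnP s) => [->//|s0]; apply: ltnW; apply: v_lt => //; try lia.
  by rewrite !g_lt_p.
have fid t : t < q.+1 -> f t = t.
  apply: strict_into_id => {t} [t t' tt' ht'|t ht]; rewrite /f.
  - case: (ltnP t' (q - p)) => h1.
      have -> : t < q - p by lia.
      by apply: chi_lt; rewrite ?hw; lia.
    case: (ltnP t (q - p)) => h2.
      have := chi_v0 t h2; case: (ltnP t' q) => h3 lt.
        by apply: leq_trans lt _; apply: v_le; lia.
      by apply: leq_trans lt _; apply: ltnW; apply: vq.
    have -> : t < q by lia.
    case: (ltnP t' q) => h3; last by apply: vq; lia.
    by apply: v_lt; [lia | lia | lia | rewrite !g_lt_p //; lia].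
  - case: ifP => h1; first by have [_] := @pi_chi t ltac:(rewrite hw; lia).
    by case: ifP => h2 //; apply: ltnW; apply: vq; lia.
split=> [t ht|s sp].
  by have := fid t; rewrite /f ht; apply; lia.
have := fid (q - p + s); rewrite /f.
have -> : (q - p + s < q - p) = false by lia.
have -> : q - p + s < q by lia.
by rewrite addKn; apply; lia.
Qed.

Lemma classification : exists p q, [/\ 0 < p < q,
  forall j, 0 < j <= n -> N (E j) = if j < a then 1 else if j < b then q + 1 - p else q + 1,
  (forall j s, 0 < j < n -> s < N (E j) ->
     pi (E j, s) = if (j.+1 == b) && (s == q - p) then (k, q) else (E j.+1, s)) /\
  (forall s, s <= q -> pi (0, s) = if s < p then (k, q - p + s)
                                   else if s == p then (k', q - p)
                                   else if s < q then (k', s - p) else (m, 0)),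
  forall s, s <= q -> [/\ dA D s = (s == p), dB D s = (s < q) && (s != p) & dC D s = (s == q)]
  & forall z, L z -> exists c, iter c pi (0, 0) = z].
Proof.
have [_ va] := entry_a; have [eb1 vb] := entry_b.
have NE j : 0 < j <= n -> N (E j) = if j < a then 1 else if j < b then q + 1 - p else q + 1.
  move=> hj; case: ltnP => ja; first by apply: N_R; lia.
  case: ltnP => jb; last by rewrite N_T ?addn1; lia.
  by rewrite N_S ?hNa ?hw; lia.
exists p, q; split=> //; first by rewrite p_gt0.
- split=> [j s hj hs|s sq].
    have [jb|jb] := eqVneq j.+1 b.
      have ej : j = b.-1 by lia.
      move: hs; rewrite ej hNb1 ltnS => sw; have [-> _] := pi_chi sw.
      rewrite prednK ?eb /=; last by lia.
      case: eqP => [->|sn]; first by rewrite -hw chi_w.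
      by rewrite eb1 //; lia.
    have [ja|ja] := eqVneq j.+1 a.
      by move: hs; rewrite NE ?ifT; [case: s => // _; rewrite pi_base_E | lia | lia].
    by have [_ ->] := pi_generic hj ja jb.
  rewrite pi0E; case: (ltngtP s p) => sp.
  - by rewrite g_lt_p // vb.
  - case: (ltngtP s q) sq => // sq _; last by rewrite -pi0E sq pi_q.
    by rewrite g_ge_p ?va //; lia.
  - by rewrite sp g_ge_p ?v_p ?hw //; lia.
- move=> s; rewrite leq_eqVlt => /orP[/eqP ->|sq].
    have hq : q < N 0 by rewrite hN0.
    have [-> -> ->] := class_eq hq q_gt0 pi_q.
    by rewrite ltnn eqxx; split=> //; lia.
  have [-> -> ->] := classes_lt sq.
  by rewrite sq; split=> //; lia.
- by move=> z; apply: reach; exact: L0.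
Qed.

End Classification.

(** * From the classification to the bijection *)

Lemma inTT_is_Pdata n m i a b D :
  1 < m -> m < n -> coprime m n -> 1 < a < b -> b <= n ->
  orbitn n m a = kk n m i.+1 -> orbitn n m b = kk n m i -> kk n m i < kk n m i.+1 < m ->
  (forall j, 0 < j <= n -> kk n m i < orbitn n m j < m -> j <= a) ->
  inTT n m (kk n m i) cB D ->
  exists p q, [/\ 0 < p < q, coprime p q & data_eq n D (Pdata n m i p q)].
Proof.
move=> m_gt1 m_lt_n co ab bn ea eb hkk late.
case=> x0 [star [[lab [h1 [h2 [h3 [h4 h5]]]]] [e00 [B0 [TTa [TTb [TTc _]]]]]]].
have [p [q [hpq NE [piE pi0E] cls reach]]] := classification m_gt1 m_lt_n co ab bn ea eb
  hkk late star h1 h2 h3 h4 h5 e00 B0 TTa TTb TTc.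
have n_gt0 : 0 < n by lia.
set P := Pdata n m i p q.
have NP r : r < n -> dN D r = dN P r.
  move=> /(orbitn_surj n_gt0 co) [j hj <-].
  by rewrite NE // (Pdata_N m_gt1 m_lt_n co ab bn ea eb hkk hpq).
have N0 : dN D 0 = q + 1.
  have := NE n; rewrite orbitn_n n_gt0 leqnn => -> //.
  by have [-> ->] : (n < a) = false /\ (n < b) = false by split; lia.
have piP r s : r < n -> s < dN D r -> dpi D (r, s) = dpi P (r, s).
  move=> /(orbitn_surj n_gt0 co) [j hj <-] hs.
  have [jn|jn] : j = n \/ j < n by lia.
    move: hs; rewrite jn orbitn_n N0 => hs.
    by rewrite pi0E ?Pdata_pi0 //; lia.
  by rewrite piE ?(Pdata_pi m_gt1 m_lt_n co ab bn ea eb hkk hpq) //; lia.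
(* The gcd divides the arrival index 0 of [(0,0)], and [ret] preserves this divisibility; the orbit
   contains [(0,1)], so the gcd is 1. *)
have co_pq : coprime p q.
  pose d := gcdn p q.
  have dp : d %| p := dvdn_gcdl p q.
  have dq : d %| q := dvdn_gcdr p q.
  have step := Pdata_step m_gt1 m_lt_n co ab bn ea eb hkk hpq.
  pose ar z := arrival n m i p q z.1 z.2.
  have a0 s : ar (0, s) = s by exact: arrival0 m_gt1 m_lt_n co ab bn ea eb hkk hpq s.
  have inv c : label n P (iter c (dpi D) (0, 0)) /\ d %| ar (iter c (dpi D) (0, 0)).
    elim: c => [|c [Lz dz]].
      by rewrite a0 labelE -NP // N0 n_gt0 addn1.
    rewrite iterS; case: (iter c _ _) Lz dz => r s Lz dz.
    have := Lz; rewrite labelE => /andP[hr]; rewrite -NP // => hs.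
    rewrite piP //; have [Lz' _ e] := step r s Lz; split=> //.
    rewrite /ar e; case: eqP => [r0|//]; rewrite r0 a0 in dz.
    by rewrite /ret; do !case: ifP => // _; rewrite ?dvdn_add ?dvdn_sub.
  have [c hc] := reach (0, 1) ltac:(by rewrite labelE n_gt0 N0; lia).
  by have [_] := inv c; rewrite hc a0 dvdn1.
exists p, q; split=> //; split=> //; split=> // s; rewrite N0 => hs.
by have [] := cls s ltac:(lia).
Qed.

Theorem theorem2p22 (m n i : nat) :
  1 < m -> 2 * m < n -> coprime m n -> 1 <= i < alpha n m ->
  (* well defined: each P_{i,p/q,m/n} lies in TT(m/n,k_i,B) *)
  (forall p q, 0 < p < q -> coprime p q ->
     inTT n m (kk n m i) cB (Pdata n m i p q)) /\
  (* injective *)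
  (forall p q p' q', 0 < p < q -> coprime p q -> 0 < p' < q' -> coprime p' q' ->
     data_eq n (Pdata n m i p q) (Pdata n m i p' q') -> p = p' /\ q = q') /\
  (* surjective *)
  (forall D, inTT n m (kk n m i) cB D ->
     exists p q, [/\ 0 < p < q, coprime p q & data_eq n D (Pdata n m i p q)]).
Proof.
move=> m_gt1 m2n co hi.
have m_lt_n : m < n by lia.
have n_gt0 : 0 < n by lia.
have hkk := kk_lt m_gt1 m_lt_n co hi.
have [a [b [ab bn ea eb late]]] := kk_times m_gt1 m_lt_n co hi.
split; [|split].
- by move=> p q hpq copq; exact: (inTT_Pdata m_gt1 m_lt_n co ab bn ea eb hkk hpq copq late).
(* [N_0 = q + 1] recovers [q], and the class A recovers [p]. *)
- move=> p q p' q' hpq _ hpq' _ [eN [_ eABC]].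
  have N0 u v : 0 < u < v -> dN (Pdata n m i u v) 0 = v + 1.
    move=> huv; have := Pdata_N m_gt1 m_lt_n co ab bn ea eb hkk huv (j := n).
    rewrite orbitn_n n_gt0 leqnn => -> //.
    by have [-> ->] : (n < a) = false /\ (n < b) = false by split; lia.
  have := eN 0 n_gt0; rewrite !N0 // => eq; split; last by lia.
  have [|+ _] := eABC p; first by rewrite N0 //; lia.
  by rewrite /= eqxx => /esym/eqP.
- by move=> D; exact: (inTT_is_Pdata m_gt1 m_lt_n co ab bn ea eb hkk late).
Qed.
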